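(* Let $\alpha<-1$. Then the mean-square random dynamical system $\phi$ generated by the scalar mean-field stochastic differential equation $$\mathrm{d}X_t=\big(\alpha X_t+\mathbb{E}X_t-X_t\,\mathbb{E}X_t^2\big)\,\mathrm{d}t+X_t\,\mathrm{d}W_t$$ has a pullback attractor $\{A_t\}_{t\in\mathbb{R}}$ with component sets $A_t=\{0\}$ for all $t\in\mathbb{R}$.
   Context: Let $\{W_t\}_{t\in\mathbb{R}}$ be a two-sided scalar Wiener process on a complete probability space $(\Omega,\mathcal{F},\mathbb{P})$, and let $\{\mathcal{F}_t\}_{t\in\mathbb{R}}$ be its natural filtration ($\mathcal{F}_t$ is generated by the increments $W_u-W_v$, $v\le u\le t$, and the $\mathbb{P}$-null sets). Put $\mathfrak{X}:=L^2(\Omega,\mathcal{F};\mathbb{R})$ and $\mathfrak{X}_t:=L^2(\Omega,\mathcal{F}_t;\mathbb{R})$ with norm $\|X\|_{\rm ms}:=\sqrt{\mathbb{E}|X|^2}$. Here $\mathbb{E}X_t^2$ means $\mathbb{E}(X_t^2)$. The mean-square random dynamical system (MS-RDS) generated by the equation: $\phi(t,s,\cdot):\mathfrak{X}_s\to\mathfrak{X}_t$, $t\ge s$, with $\phi(t,s,X_s):=X_t$, where $\{X_t\}_{t\ge s}$, $X_t\in\mathfrak{X}_t$, is the unique solution with initial value $X_s$ at time $s$, i.e. $X_t=X_s+\int_s^t(\alpha X_u+\mathbb{E}X_u-X_u\mathbb{E}X_u^2)\,\mathrm{d}u+\int_s^tX_u\,\mathrm{d}W_u$ (Itô integral). A family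 $\mathcal{D}=\{D_t\}_{t\in\mathbb{R}}$ with $D_t\subset\mathfrak{X}_t$ is uniformly bounded if there is $R>0$ with $\|X\|_{\rm ms}\le R$ for all $X\in D_t$ and $t\in\mathbb{R}$. Pullback attractor: a family $\mathcal{A}=\{A_t\}_{t\in\mathbb{R}}$ of nonempty compact subsets of $\mathfrak{X}$ with $A_t\subset\mathfrak{X}_t$ for each $t$, which is invariant, i.e. $\phi(t,s,A_s)=A_t$ for $t\ge s$, and which pullback attracts all uniformly bounded families $\mathcal{D}=\{D_t\}_{t\in\mathbb{R}}$ of (nonempty) subsets of $\{\mathfrak{X}_t\}_{t\in\mathbb{R}}$, i.e. $\lim_{s\to-\infty}\mathrm{dist}(\phi(t,s,D_s),A_t)=0$ for each $t\in\mathbb{R}$, where $\mathrm{dist}(D,A)=\sup_{x\in D}\inf_{y\in A}\|x-y\|_{\rm ms}$ is the Hausdorff semi-distance. *)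

(* Defs.v *)
From HB Require Import structures.
From mathcomp Require Import all_boot all_order all_algebra.
From mathcomp Require Import all_classical all_reals all_analysis.
From mathcomp Require Import measurable_realfun.

Set Implicit Arguments.
Unset Strict Implicit.
Unset Printing Implicit Defensive.

Import Order.TTheory GRing.Theory Num.Theory.
Import numFieldNormedType.Exports.

Local Open Scope classical_set_scope.
Local Open Scope ring_scope.

Section mean_square_space.
Context {d : measure_display} {T : measurableType d} {R : realType}.
Variable P : probability T R.

Definition ms_norm (f : T -> R) : R := fine ('N[P]_2%:E[EFin \o f])%E.

(* Elements are classes of random variables modulo P-a.e. equality. *)
Definition msspace : Type := LspaceType2 P.

HB.instance Definition _ := gen_eqMixin msspace.
HB.instance Definition _ := gen_choiceMixin msspace.

(* [aqEqMfun_to_fun] chooses a representative of the class. *)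
Definition msspace_fun (X : msspace) : T -> R :=
  aqEqMfun_to_fun (LebesgueSpace.sort X).

End mean_square_space.
Coercion msspace_fun : msspace >-> Funclass.

Section mean_square_metric.
Context {d : measure_display} {T : measurableType d} {R : realType}.
Variable P : probability T R.
Implicit Types X Y Z : msspace P.

Lemma msspace_Lfun X : (X : T -> R) \in Lfun P 2%:E.
Proof.
rewrite inE; apply/andP; split; rewrite inE /=.
  exact: (@measurable_funPT _ _ _ _ (repr (LebesgueSpace.sort X))).
exact: (@Lebesgue_finite _ _ _ P 2%:E (lee1n 2) X).
Qed.

Lemma ms_norm_fine (f : T -> R) : f \in Lfun P 2%:E ->
  (ms_norm P f)%:E = ('N[P]_2%:E[EFin \o f])%E.
Proof. by move=> fP; rewrite -(finite_norm_fine (Lfun_Sub (lee1n 2) fP)). Qed.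

Lemma ms_norm_eq0 (f : T -> R) : f \in Lfun P 2%:E ->
  ms_norm P f = 0 -> f = 0 %[ae P].
Proof.
by move=> fP f0; apply: (@fine_Lnormr_eq0 _ _ _ P _ (lee1n 2) (Lfun_Sub _ fP)).
Qed.

Definition msdist X Y : R := ms_norm P (fun w => X w - Y w).

Lemma msspace_subLfun X Y : (fun w => X w - Y w) \in Lfun P 2%:E.
Proof.
have h := LfunP (Lfun_Sub (lee1n 2) (msspace_Lfun X) -
                 Lfun_Sub (lee1n 2) (msspace_Lfun Y)).
exact: h.
Qed.

Lemma msspace_eq X Y : X = Y %[ae P] -> X = Y.
Proof.
case: X Y => [f [[fP]]] [g [[gP]]] fg.
have {}fg : f = g.
  have /eqP := introT (ae_eqP f g) fg.
  by rewrite !reprK.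
by move: fP gP; rewrite fg => fP gP; rewrite (Prop_irrelevance fP gP).
Qed.

Lemma msdistxx X : msdist X X = 0.
Proof.
rewrite /msdist /ms_norm (_ : _ \o _ = cst 0%E) ?Lnorm0//.
by apply/funext => w /=; rewrite subrr.
Qed.

Lemma msdist_positivity X Y : msdist X Y = 0 -> X = Y.
Proof.
move=> /(ms_norm_eq0 (msspace_subLfun X Y)) XY; apply: msspace_eq.
by apply: filterS XY => w /(_ I) XYw _; apply/eqP; rewrite -subr_eq0; apply/eqP.
Qed.

Lemma msdist_sym X Y : msdist X Y = msdist Y X.
Proof.
rewrite /msdist /ms_norm -oppe_Lnorm; congr (fine _); apply: eq_Lnorm => w /=.
by rewrite opprB.
Qed.

Lemma msdist_triangle Y X Z : msdist X Z <= msdist X Y + msdist Y Z.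
Proof.
rewrite -lee_fin EFinD !ms_norm_fine ?msspace_subLfun//.
have mfB U V : measurable_fun setT (fun w => (U : msspace P) w - (V : msspace P) w).
  by have /andP[/[!inE]] := msspace_subLfun U V.
have := @eminkowski _ _ _ P (fun w => X w - Y w) (fun w => Y w - Z w) 2%:E
  (mfB X Y) (mfB Y Z) (lee1n 2).
apply: le_trans; rewrite le_eqVlt; apply/orP; left; apply/eqP.
by apply: eq_Lnorm => w /=; rewrite addrA subrK.
Qed.

HB.instance Definition _ := @isMetric.Build R (msspace P)
  (@msdist) msdistxx msdist_positivity msdist_sym msdist_triangle.

Definition ms0_aeq : {mfun_ P, T >-> measurableTypeR R} :=
  \pi_({mfun_ P, T >-> measurableTypeR R})%qT (cst (0 : measurableTypeR R)).

Lemma ms0_aeqE : ms0_aeq = (cst 0 : T -> R) %[ae P].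
Proof.
have /eqP := reprK ms0_aeq; rewrite /ms0_aeq.
by rewrite eqmodE => /asboolP.
Qed.

Lemma ms0_subproof : finite_norm P 2%:E ms0_aeq.
Proof.
rewrite /finite_norm unlock /Lnorm poweR_lty//.
rewrite (@ae_eq_integral _ _ _ P setT (cst 0%E))//=.
- by rewrite integral_cst// mul0e ltry.
- apply/measurable_EFinP; apply: (measurableT_comp (measurable_powR _)) => //.
  exact: measurableT_comp.
- apply: filterS ms0_aeqE => w /(_ I) w0 _.
  by rewrite w0 /= normr0 powR0.
Qed.

HB.instance Definition _ := isFinLebesgue.Build _ _ _ P 2%:E (lee1n 2)
  ms0_aeq ms0_subproof.

Definition ms0 : msspace P := (ms0_aeq : LspaceType2 P).

End mean_square_metric.

Section wiener.
Context {d : measure_display} {T : measurableType d} {R : realType}.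
Variables (P : probability T R) (W : R -> T -> R).

Definition increment (s t : R) (w : T) : R := W t w - W s w.

Record two_sided_wiener : Prop := TwoSidedWiener {
  wiener_measurable : forall t, measurable_fun setT (W t) ;
  wiener_origin : {ae P, forall w, W 0 w = 0} ;
  (* The second parameter of [normal_prob] is the standard deviation. *)
  wiener_gaussian : forall s t, s < t -> forall B : set R, measurable B ->
    P (increment s t @^-1` B) = normal_prob 0 (Num.sqrt (t - s)) B ;
  (* Taking some of the [B i] to be [setT] gives the product rule for every
     subfamily, i.e. mutual independence of the increments. *)
  wiener_independent : forall (n : nat) (t : nat -> R),
    (forall i, (i < n)%N -> t i <= t i.+1) ->
    forall B : nat -> set R, (forall i, measurable (B i)) ->
    P (\bigcap_(i < n) increment (t i) (t i.+1) @^-1` (B i)) =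
    (\prod_(i < n) P (increment (t i) (t i.+1) @^-1` (B i)))%E ;
  wiener_continuous : {ae P, forall w, continuous (W ^~ w)}
}.

Definition natural_filtration (t : R) : set_system T :=
  <<s [set A | exists u v, [/\ v <= u, u <= t &
         exists2 B : set R, measurable B &
           A = increment v u @^-1` B]]
      `|` P.-negligible >>.

Definition filtration_measurable (t : R) (X : T -> R) : Prop :=
  forall B : set R, measurable B -> natural_filtration t (X @^-1` B).

(* The subspace of classes of [F_t]-measurable variables. As [F_t] contains the
   null sets, the choice of representative is irrelevant. *)
Definition msspace_at (t : R) : set (msspace P) :=
  [set X | filtration_measurable t X].

Record step_process := StepProcess {
  step_size : nat ;
  step_time : nat -> R ;
  step_coef : nat -> T -> R
}.

Definition step_fun (h : step_process) (u : R) (w : T) : R :=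
  \sum_(i < step_size h)
    step_coef h i w * \1_`[step_time h i, step_time h i.+1[ u.

Definition step_integral (h : step_process) (w : T) : R :=
  \sum_(i < step_size h)
    step_coef h i w * increment (step_time h i) (step_time h i.+1) w.

Definition is_step_process (s t : R) (h : step_process) : Prop :=
  [/\ step_time h 0 = s, step_time h (step_size h) = t &
    forall i, (i < step_size h)%N ->
    [/\ step_time h i <= step_time h i.+1,
        filtration_measurable (step_time h i) (step_coef h i) &
        exists C, forall w, `|step_coef h i w| <= C]].

Definition ito_integrand (s t : R) (H : R -> T -> R) : Prop :=
  [/\ measurable_fun (`[s, t] `*` setT) (fun p : R * T => H p.1 p.2),
      forall u, s <= u <= t -> filtration_measurable u (H u) &
      (\int[lebesgue_measure]_(u in `[s, t]) \int[P]_w ((H u w) ^+ 2)%:E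
        < +oo)%E].

(* [I] is a version of the Ito integral of [H] over [s, t]: the mean-square
   limit of the elementary integrals of step processes approximating [H] in
   L^2([s, t] x T). *)
Definition is_ito_integral (s t : R) (H : R -> T -> R) (I : T -> R) : Prop :=
  [/\ ito_integrand s t H, I \in Lfun P 2%:E &
    exists h : nat -> step_process,
    [/\ forall n, is_step_process s t (h n),
        (\int[lebesgue_measure]_(u in `[s, t])
           \int[P]_w ((step_fun (h n) u w - H u w) ^+ 2)%:E)%E
          @[n --> \oo] --> 0%E &
        ('N[P]_2%:E[(fun w => (step_integral (h n) w - I w)%:E)])%E
          @[n --> \oo] --> 0%E]].

Definition mf_drift (alpha : R) (Y : R -> T -> R) (u : R) (w : T) : R :=
  alpha * Y u w + fine ('E_P[Y u])%E
  - Y u w * fine ('E_P[fun w' => (Y u w' ^+ 2)%R])%E.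

(* Joint measurability gives a meaning to the pathwise time integral; together
   with mean-square continuity it makes almost every path of the drift
   Lebesgue integrable on bounded intervals. *)
Record mf_solution (alpha s : R) (X : T -> R) (Y : R -> T -> R) : Prop :=
  MfSolution {
  mf_square_integrable : forall t, s <= t -> Y t \in Lfun P 2%:E ;
  mf_adapted : forall t, s <= t -> filtration_measurable t (Y t) ;
  mf_measurable :
    measurable_fun (`[s, +oo[ `*` setT) (fun p : R * T => Y p.1 p.2) ;
  mf_continuous : forall t, s <= t ->
    ('N[P]_2%:E[(fun w => (Y u w - Y t w)%:E)])%E
      @[u --> within `[s, +oo[ (nbhs t)] --> 0%E ;
  mf_equation : forall t, s <= t ->
    exists2 I, is_ito_integral s t Y I &
    {ae P, forall w, Y t w =
       X w + \int[lebesgue_measure]_(u in `[s, t]) mf_drift alpha Y u w + I w}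
}.

(* Only the values [phi t s X] with [s <= t] and [X] in [msspace_at s] matter:
   [phi t s] stands for a map from [msspace_at s] to [msspace_at t]. *)
Definition generated_ms_rds (alpha : R)
    (phi : R -> R -> msspace P -> msspace P) : Prop :=
  forall (s : R) (X : msspace P), msspace_at s X ->
  exists2 Y, mf_solution alpha s X Y &
    forall t, s <= t -> phi t s X = Y t %[ae P].

Definition hausdorff_semidist (D A : set (msspace P)) : \bar R :=
  ereal_sup [set ereal_inf [set (mdist x y)%:E | y in A] | x in D].

Definition uniformly_bounded (D : R -> set (msspace P)) : Prop :=
  exists2 r : R, 0 < r & forall t X, D t X -> ms_norm P X <= r.

Record pullback_attractor (phi : R -> R -> msspace P -> msspace P)
    (A : R -> set (msspace P)) : Prop := PullbackAttractor {
  attractor_nonempty : forall t, A t !=set0 ;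
  attractor_compact : forall t, compact (A t) ;
  attractor_adapted : forall t, A t `<=` msspace_at t ;
  attractor_invariant : forall s t, s <= t -> phi t s @` A s = A t ;
  attractor_attracts : forall D : R -> set (msspace P),
    (forall t, D t !=set0) -> (forall t, D t `<=` msspace_at t) ->
    uniformly_bounded D ->
    forall t, hausdorff_semidist (phi t s @` D s) (A t) @[s --> -oo] --> 0%E
}.

End wiener.

(* Main.v *)
Require Import Defs.
From mathcomp Require Import all_boot all_order all_algebra.
From mathcomp Require Import all_classical all_reals all_analysis.
From mathcomp Require Import measurable_realfun ring lra.

Import Order.TTheory GRing.Theory Num.Theory.
Import numFieldNormedType.Exports.

Local Open Scope classical_set_scope.
Local Open Scope ring_scope.

Set Implicit Arguments.
Unset Strict Implicit.
Unset Printing Implicit Defensive.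

(** The zero solution is globally exponentially stable in mean square, at a rate
    that is uniform on bounded sets of initial values, because the first two
    moments of a solution solve a closed system of ordinary differential
    equations. For [m1 = E Y_t] and [m2 = E Y_t^2],

      m1' = (alpha + 1 - m2) m1,
      m2' = (2 alpha + 1) m2 + 2 m1^2 - 2 m2^2.

    As [m2 >= 0], the function [m1^2 exp (- 2 (alpha + 1) (t - s))] decreases.
    With this bound on [m1^2] and [m1^2 <= m2] at the initial time, the second
    equation yields [m2 t <= 3 E X^2 exp (2 (alpha + 1) (t - s))], where [X] is
    the value at time [s] (moment_equations_decay, solution_decay). For
    [alpha < -1] the right-hand side tends to zero as [s] tends to minus infinity,
    uniformly over [E X^2 <= r^2]: this is pullback attraction by zero. With
    [X = 0] the bound says that zero is mapped to zero: this is invariance. The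
    bound holds for every solution with value [X] at time [s], hence for the one
    that the system follows.

    The moment equations follow from two properties of the stochastic integral.
    Over [[r, t]] the increment of [Y] is that of the accumulated drift plus that of
    the stochastic integral. The latter is orthogonal to every square-integrable
    variable known at time [r] (ito_orthogonal), and its squared norm is the
    integral of [m2] over [[r, t]] (ito_isometry, ito_increment_sqr). This turns
    the increment of [m2] into an integral over [[r, t]] whose integrand depends on
    [r] and [t], but converges when [r], [t] and the variable of integration tend
    to the same point; this is enough to differentiate (m2_increment,
    is_derive_increment). The equation for [m1] arises in the same way.

    Both properties are proved for elementary integrands and extended by
    mean-square limits. They rest on the independence of an increment of the
    Wiener process from the filtration at its beginning
    (natural_filtration_indep), on the product rule for expectations
    (expectation_indep_mul), and on the mean and the variance of the increments. *)

(** * Mean-square calculus *)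

Section mean_square_calculus.
Context {d : measure_display} {T : measurableType d} {R : realType}.
Variable P : probability T R.
Implicit Types f g h : T -> R.

Definition ip f g : R := \int[P]_w (f w * g w).

Definition L2 f : Prop := f \in Lfun P 2%:E.

Lemma L2_measurable f : L2 f -> measurable_fun setT f.
Proof. by move=> /sub_Lfun_mfun; rewrite inE. Qed.

Lemma L2_ip_integrable f g : L2 f -> L2 g ->
  P.-integrable setT (EFin \o (fun w => f w * g w)).
Proof. by move=> f2 g2; apply/Lfun1_integrable/Lfun2_mul_Lfun1. Qed.

Lemma L2_cst (c : R) : L2 (cst c).
Proof. exact: Lfun_cst. Qed.

Lemma L2D f g : L2 f -> L2 g -> L2 (f \+ g).
Proof.
move=> f2 g2.
exact: (LfunP (Lfun_Sub (lee1n 2) f2 + Lfun_Sub (lee1n 2) g2)).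
Qed.

Lemma L2B f g : L2 f -> L2 g -> L2 (f \- g).
Proof.
move=> f2 g2.
exact: (LfunP (Lfun_Sub (lee1n 2) f2 - Lfun_Sub (lee1n 2) g2)).
Qed.

Lemma L2Z (a : R) f : L2 f -> L2 (fun w => a * f w).
Proof.
move=> f2; have := @Lfun_scale _ _ _ P f a 2 (ler1n _ 2) f2.
by rewrite (_ : _ \o* _ = fun w => a * f w)//; apply/funext => w /=; rewrite mulrC.
Qed.

Lemma L2_integrable f : L2 f -> P.-integrable setT (EFin \o f).
Proof.
move=> f2; apply/Lfun1_integrable/Lfun_subset12 => //.
by rewrite fin_num_measure.
Qed.

Lemma L2_sqr f : measurable_fun setT f ->
  P.-integrable setT (EFin \o (fun w => f w ^+ 2)) -> L2 f.
Proof.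
move=> mf /integrableP[_ fi]; rewrite /L2 inE; apply/andP; split; rewrite inE//=.
rewrite /finite_norm unlock /Lnorm poweR_lty//.
apply: le_lt_trans fi; rewrite le_eqVlt; apply/orP; left; apply/eqP.
apply: eq_integral => w _ /=.
by rewrite powR_mulrn// -normrX.
Qed.

Lemma L2_bounded f (c : R) : measurable_fun setT f ->
  (forall w, `|f w| <= c) -> L2 f.
Proof.
move=> mf fc; apply: L2_sqr => //.
apply: (@le_integrable _ _ _ P setT measurableT _ (EFin \o cst (c ^+ 2))).
- by apply/measurable_EFinP/measurable_funX.
- move=> w _ /=; rewrite lee_fin normrX [leRHS]ger0_norm ?sqr_ge0//.
  by rewrite ler_sqr ?nnegrE// (le_trans _ (fc w)).
- exact: finite_measure_integrable_cst.
Qed.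

Lemma L2_bounded_mul f g (c : R) : L2 f -> measurable_fun setT g ->
  (forall w, `|g w| <= c) -> L2 (fun w => f w * g w).
Proof.
move=> f2 mg gc; have mf := L2_measurable f2.
have mfg : measurable_fun setT (fun w => f w * g w) by exact: measurable_funM.
apply: L2_sqr => //.
apply: (@le_integrable _ _ _ P setT measurableT _
    (EFin \o (fun w => (c * f w) * (c * f w)))).
- exact/measurable_EFinP/measurable_funX.
- move=> w _ /=; rewrite lee_fin -expr2 !normrX ler_sqr ?nnegrE// !normrM mulrC.
  by rewrite ler_wpM2r// (le_trans (gc w))// ler_norm.
- by apply: L2_ip_integrable; exact: L2Z.
Qed.

Lemma ipC f g : ip f g = ip g f.
Proof. by apply: eq_Rintegral => w _; rewrite mulrC. Qed.

Lemma eq_ip f f' g g' : f =1 f' -> g =1 g' -> ip f g = ip f' g'.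
Proof. by move=> ff gg; apply: eq_Rintegral => w _; rewrite ff gg. Qed.

Lemma ip_eq0 f g : (forall w, f w * g w = 0) -> ip f g = 0.
Proof.
move=> fg; rewrite /ip (@eq_Rintegral _ _ _ P setT (cst 0)) => [|w _]; last exact: fg.
by rewrite Rintegral_cst// mul0r.
Qed.

Lemma ipDl f g h : L2 f -> L2 g -> L2 h -> ip (f \+ g) h = ip f h + ip g h.
Proof.
move=> f2 g2 h2; rewrite /ip -RintegralD//; try exact: L2_ip_integrable.
by apply: eq_Rintegral => w _ /=; rewrite mulrDl.
Qed.

Lemma ipBl f g h : L2 f -> L2 g -> L2 h -> ip (f \- g) h = ip f h - ip g h.
Proof.
move=> f2 g2 h2; rewrite /ip -RintegralB//; try exact: L2_ip_integrable.
by apply: eq_Rintegral => w _ /=; rewrite mulrBl.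
Qed.

Lemma ipZl (a : R) f g : L2 f -> L2 g -> ip (fun w => a * f w) g = a * ip f g.
Proof.
move=> f2 g2; rewrite /ip -RintegralZl//; try exact: L2_ip_integrable.
by apply: eq_Rintegral => w _ /=; rewrite mulrA.
Qed.

Lemma ipDr f g h : L2 f -> L2 g -> L2 h -> ip h (f \+ g) = ip h f + ip h g.
Proof. by move=> *; rewrite ipC ipDl// !(ipC h). Qed.

Lemma ipBr f g h : L2 f -> L2 g -> L2 h -> ip h (f \- g) = ip h f - ip h g.
Proof. by move=> *; rewrite ipC ipBl// !(ipC h). Qed.

Lemma ipZr (a : R) f g : L2 f -> L2 g -> ip g (fun w => a * f w) = a * ip g f.
Proof. by move=> *; rewrite ipC ipZl// ipC. Qed.

Lemma ip_ge0 f : 0 <= ip f f.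
Proof. by apply: Rintegral_ge0 => w _; rewrite -expr2 sqr_ge0. Qed.

Lemma ip_cst1 : ip (cst 1) (cst 1) = 1.
Proof.
transitivity (\int[P]_(w in setT) 1).
  by apply: eq_Rintegral => w _ /=; rewrite mulr1.
by rewrite Rintegral_cst// mul1r /= probability_setT.
Qed.

Lemma ip_fin f g : L2 f -> L2 g -> ((ip f g)%:E = \int[P]_w (f w * g w)%:E)%E.
Proof.
by move=> f2 g2; rewrite fineK//; apply: integrable_fin_num => //; exact: L2_ip_integrable.
Qed.

(** The quadratic polynomial [x |-> ip (f - x g) (f - x g)] is nonnegative. *)
Lemma ip_cauchy_schwarz f g : L2 f -> L2 g -> (ip f g) ^+ 2 <= ip f f * ip g g.
Proof.
move=> f2 g2.
have H (x : R) : 0 <= ip f f - 2 * x * ip f g + x ^+ 2 * ip g g.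
  have := ip_ge0 (f \- (fun w => x * g w)).
  have x2 := L2Z x g2.
  rewrite ipBl//; last exact: L2B.
  rewrite !ipBr// ipZl// !ipZr// ipZl// (ipC g f).
  by move=> /le_trans; apply; rewrite le_eqVlt; apply/orP; left; apply/eqP; ring.
have g0 := ip_ge0 g; have f0 := ip_ge0 f.
have [gE|gN] := eqVneq (ip g g) 0.
  (* The polynomial is then affine, and would be negative at this point if its
     slope did not vanish. *)
  rewrite gE mulr0.
  have H1 := H ((ip f f + 1) / (2 * ip f g)).
  have [->|fgN] := eqVneq (ip f g) 0; first by rewrite expr0n.
  move: H1; rewrite gE mulr0 addr0.
  have -> : 2 * ((ip f f + 1) / (2 * ip f g)) * ip f g = ip f f + 1 by field.
  lra.
have gp : 0 < ip g g by rewrite lt_def gN.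
have := H (ip f g / ip g g).
have -> : ip f f - 2 * (ip f g / ip g g) * ip f g + (ip f g / ip g g) ^+ 2 * ip g g
   = (ip f f * ip g g - ip f g ^+ 2) / ip g g by field.
by rewrite pmulr_lge0 ?invr_gt0// subr_ge0.
Qed.

(** The difference of two squares is the product of the difference [g + h] and
    the sum [k + f] of the two variables. As [f] and [h] are orthogonal, the part
    of this product along [h] keeps, besides [ip h h], only terms paired with
    [g]. When [g] is small, the whole increment is then [ip h h] plus a pairing
    of [g] with nearly [2 f]. *)
Lemma ip_sqr_increment f g h k : L2 f -> L2 g -> L2 h -> ip f h = 0 ->
  k = (f \+ g) \+ h ->
  ip k k - ip f f = ip ((k \+ f) \+ h) g + ip h h.
Proof.
move=> f2 g2 h2 fh ->; have fg2 := L2D f2 g2; have k2 := L2D fg2 h2.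
rewrite (ipDl (L2D k2 f2) h2 g2) (ipDl k2 f2 g2) (ipDl fg2 h2 k2).
rewrite (ipDl f2 g2 k2) (ipDl fg2 h2 g2) (ipDl f2 g2 g2).
rewrite (ipDr fg2 h2 f2) (ipDr fg2 h2 g2) (ipDr fg2 h2 h2).
rewrite (ipDr f2 g2 f2) (ipDr f2 g2 g2) (ipDr f2 g2 h2).
by rewrite (ipC h f) (ipC g f) (ipC h g) fh; ring.
Qed.

Definition l2n f : R := Num.sqrt (ip f f).

Lemma l2n_ge0 f : 0 <= l2n f. Proof. exact: sqrtr_ge0. Qed.

Lemma sqr_l2n f : l2n f ^+ 2 = ip f f.
Proof. by rewrite sqr_sqrtr// ip_ge0. Qed.

Lemma ip_le_l2n f g : L2 f -> L2 g -> `|ip f g| <= l2n f * l2n g.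
Proof.
move=> f2 g2; rewrite -ler_sqr ?nnegrE ?mulr_ge0 ?l2n_ge0//.
by rewrite exprMn !sqr_l2n -normrX ger0_norm ?sqr_ge0// ip_cauchy_schwarz.
Qed.

Lemma l2nD f g : L2 f -> L2 g -> l2n (f \+ g) <= l2n f + l2n g.
Proof.
move=> f2 g2; rewrite -ler_sqr ?nnegrE ?addr_ge0 ?l2n_ge0// sqr_l2n.
rewrite ipDl ?ipDr//; last exact: L2D.
rewrite sqrrD !sqr_l2n (ipC g f).
have := ip_le_l2n f2 g2; move: (ler_norm (ip f g)).
move: (ip f g) (l2n f * l2n g) `|_| => a b c; lra.
Qed.

Lemma l2nZ (a : R) f : L2 f -> l2n (fun w => a * f w) = `|a| * l2n f.
Proof.
move=> f2; rewrite /l2n ipZl ?ipZr//; last exact: L2Z.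
by rewrite mulrA -expr2 sqrtrM ?sqr_ge0// sqrtr_sqr.
Qed.

Lemma LnormE f : L2 f -> ('N[P]_2%:E[EFin \o f])%E = (l2n f)%:E.
Proof.
move=> f2; rewrite unlock /Lnorm.
transitivity ((ip f f)%:E `^ (2%R)^-1)%E; last first.
  by rewrite poweR_EFin powR12_sqrt ?ip_ge0.
congr (_ `^ _)%E; rewrite ip_fin//; apply: eq_integral => w _ /=.
by rewrite powR_mulrn// -normrX expr2 ger0_norm// -expr2 sqr_ge0.
Qed.

Lemma ms_normE f : L2 f -> ms_norm P f = l2n f.
Proof. by move=> f2; rewrite /ms_norm LnormE. Qed.

Section ms_convergence.
Context {I : Type} (F : set_system I) {FF : ProperFilter F}.

Lemma squeeze_cvg0 (u v : I -> R) : (forall i, 0 <= u i <= v i) ->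
  v i @[i --> F] --> 0 -> u i @[i --> F] --> 0.
Proof.
move=> uv /cvgrPdist_le v0; apply/cvgrPdist_le => e e0.
have := v0 _ e0; apply: filterS => i; rewrite !sub0r !normrN.
have /andP[u0 uvi] := uv i; rewrite !ger0_norm ?(le_trans u0)//.
exact: le_trans.
Qed.

(** Convergence along an arbitrary filter, as the limits below are taken over
    indices, over times, and over triples of times. *)
Definition ms_cvg (A : I -> T -> R) (a : T -> R) : Prop :=
  l2n (A i \- a) @[i --> F] --> 0.

Lemma ms_cvg_cst a : ms_cvg (fun=> a) a.
Proof.
rewrite /ms_cvg (_ : l2n _ = 0); first exact: cvg_cst.
by rewrite /l2n /ip; under eq_Rintegral do rewrite /= subrr mul0r;
  rewrite Rintegral_cst// mul0r sqrtr0.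
Qed.

Lemma ms_cvgD A B a b : (forall i, L2 (A i)) -> (forall i, L2 (B i)) ->
  L2 a -> L2 b -> ms_cvg A a -> ms_cvg B b ->
  ms_cvg (fun i => A i \+ B i) (a \+ b).
Proof.
move=> A2 B2 a2 b2 Aa Bb.
have AB : l2n (A i \- a) + l2n (B i \- b) @[i --> F] --> 0.
  by rewrite -[X in _ --> X]addr0; exact: cvgD.
apply: squeeze_cvg0 AB => i.
rewrite l2n_ge0/=.
have -> : (A i \+ B i) \- (a \+ b) = (A i \- a) \+ (B i \- b).
  by apply/funext => w /=; ring.
by apply: l2nD; exact: L2B.
Qed.

Lemma ms_cvgB A B a b : (forall i, L2 (A i)) -> (forall i, L2 (B i)) ->
  L2 a -> L2 b -> ms_cvg A a -> ms_cvg B b ->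
  ms_cvg (fun i => A i \- B i) (a \- b).
Proof.
move=> A2 B2 a2 b2 Aa Bb.
have AB : l2n (A i \- a) + l2n (B i \- b) @[i --> F] --> 0.
  by rewrite -[X in _ --> X]addr0; exact: cvgD.
apply: squeeze_cvg0 AB => i.
rewrite l2n_ge0/=.
have Bb2 := L2B (B2 i) b2.
have -> : (A i \- B i) \- (a \- b) = (A i \- a) \+ (fun w => -1 * (B i \- b) w).
  by apply/funext => w /=; ring.
have := l2nD (L2B (A2 i) a2) (L2Z (-1) Bb2).
by rewrite (l2nZ _ Bb2) normrN1 mul1r.
Qed.

Lemma ms_cvgZ (x : I -> R) (y : R) A a : (forall i, L2 (A i)) -> L2 a ->
  x i @[i --> F] --> y -> ms_cvg A a ->
  ms_cvg (fun i w => x i * A i w) (fun w => y * a w).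
Proof.
move=> A2 a2 xy Aa.
have h1 : `|x i| * l2n (A i \- a) @[i --> F] --> `|y| * 0.
  by apply: cvgM => //; exact: cvg_norm.
have h2 : `|x i - y| * l2n a @[i --> F] --> `|y - y| * l2n a.
  apply: cvgM; last exact: cvg_cst.
  by apply: cvg_norm; apply: cvgB => //; exact: cvg_cst.
have h : `|x i| * l2n (A i \- a) + `|x i - y| * l2n a @[i --> F] --> 0.
  rewrite (_ : 0 = `|y| * 0 + `|y - y| * l2n a); first exact: cvgD.
  by rewrite subrr normr0 mulr0 mul0r addr0.
apply: squeeze_cvg0 h => i.
rewrite l2n_ge0/= -!l2nZ//; last exact: L2B.
rewrite (_ : (fun w => _) \- _ =
   (fun w => x i * (A i \- a) w) \+ (fun w => (x i - y) * a w)).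
  by apply: l2nD; [apply: L2Z; exact: L2B|exact: L2Z].
by apply/funext => w /=; ring.
Qed.

Lemma ip_cvg A B a b : (forall i, L2 (A i)) -> (forall i, L2 (B i)) ->
  L2 a -> L2 b -> ms_cvg A a -> ms_cvg B b ->
  ip (A i) (B i) @[i --> F] --> ip a b.
Proof.
move=> A2 B2 a2 b2 Aa Bb.
have h : l2n (A i \- a) * l2n (B i \- b) + l2n (A i \- a) * l2n b +
    l2n a * l2n (B i \- b) @[i --> F] --> 0.
  rewrite (_ : 0 = 0 * 0 + 0 * l2n b + l2n a * 0); last first.
    by rewrite !mulr0 mul0r !addr0.
  by apply: cvgD; [apply: cvgD|]; apply: cvgM => //; exact: cvg_cst.
apply/cvgrPdist_le => e e0.
have /cvgrPdist_le/(_ _ e0) := h; apply: filterS => i; rewrite sub0r normrN.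
move=> /(le_trans (ler_norm _)); apply: le_trans.
have Aa2 := L2B (A2 i) a2; have Bb2 := L2B (B2 i) b2.
have -> : ip a b - ip (A i) (B i) =
  - (ip (A i \- a) (B i \- b) + ip (A i \- a) b + ip a (B i \- b)).
  rewrite !ipBl// !ipBr//; ring.
rewrite normrN (le_trans (ler_normD _ _))// lerD//; last exact: ip_le_l2n.
by rewrite (le_trans (ler_normD _ _))// lerD//; exact: ip_le_l2n.
Qed.

End ms_convergence.

End mean_square_calculus.

(** * The second moment of the normal law *)

Section normal_second_moment.
Context {R : realType}.
Notation mu := (@lebesgue_measure R).
Variable s : R.
Hypothesis s0 : 0 < s.
Local Notation g := (normal_pdf 0 s).

Let sN0 : s != 0. Proof. by rewrite gt_eqF. Qed.

Let gE x : g x = normal_peak s * expR (- (x ^+ 2) / (s ^+ 2 *+ 2)).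
Proof. by rewrite normal_pdfE// /normal_fun subr0. Qed.

Let is_derive_g (x : R) : is_derive x 1 g (- (x / s ^+ 2) * g x).
Proof.
rewrite (_ : g = (fun x => normal_peak s * expR (- (x ^+ 2) / (s ^+ 2 *+ 2))));
  last exact/funext.
have H : is_derive x 1 (fun x => expR (- (x ^+ 2) / (s ^+ 2 *+ 2)))
   (- (x / s ^+ 2) * expR (- (x ^+ 2) / (s ^+ 2 *+ 2))).
  have H1 : is_derive x 1 (fun x : R => - (x ^+ 2) / (s ^+ 2 *+ 2)) (- (x / s ^+ 2)).
    apply: is_derive_eq => /=.
    rewrite /GRing.scale /= -[s ^+ 2 *+ 2]mulr_natr; field; exact: sN0.
  by rewrite mulrC; exact: (@is_derive1_comp _ expR (fun x => - (x ^+ 2) / (s ^+ 2 *+ 2))).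
by apply: is_derive_eq => /=; rewrite /GRing.scale /=; ring.
Qed.

(* The function [f] is the difference of [(x / s)^2 g] and [g]. It has the
   elementary primitive [F], which vanishes at [0] and at infinity, so that both
   functions have the same integral over the half-line. *)
Let F x := - x * g x.
Let f x := (x ^+ 2 / s ^+ 2 - 1) * g x.

Let is_derive_F (x : R) : is_derive x 1 F (f x).
Proof.
have dg := is_derive_g x.
rewrite /F; apply: is_derive_eq; rewrite /f /GRing.scale /=.
by field; exact: sN0.
Qed.

Let cg : continuous g.
Proof. exact: continuous_normal_pdf. Qed.

Let cf : continuous f.
Proof.
move=> x; apply: cvgM; last exact: cg.
apply: cvgB; last exact: cvg_cst.
apply: cvgM; last exact: cvg_cst.
exact: exprn_continuous.
Qed.

Let cF : continuous F.
Proof. by move=> x; apply: cvgM; [apply: cvgN|exact: cg]. Qed.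

Let cvgF : F x @[x --> +oo] --> 0.
Proof.
apply/cvgrPdist_lt => e e0; near=> x.
have x0 : 0 < x by near: x; exact: nbhs_pinfty_gt.
rewrite sub0r normrN /F mulNr normrN ger0_norm ?mulr_ge0 ?normal_pdf_ge0 ?ltW//.
rewrite gE mulNr expRN mulrCA.
set k := normal_peak s; have k0 : 0 < k by rewrite normal_peak_gt0.
set y := x ^+ 2 / _.
have y0 : 0 < y by rewrite divr_gt0 ?exprn_gt0// pmulrn_lgt0// exprn_gt0.
(* exp y dominates y, so that F x decays at least like the inverse of x. *)
apply: (@le_lt_trans _ _ (k * (x * y^-1))).
  rewrite ler_wpM2l ?(ltW k0)// ler_wpM2l ?(ltW x0)// lef_pV2 ?posrE ?expR_gt0//.
  by rewrite (le_trans _ (expR_ge1Dx _))// lerDr.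
rewrite (_ : k * (x / y) = k * (s ^+ 2 *+ 2) / x); last first.
  rewrite /y -[s ^+ 2 *+ 2]mulr_natr; field.
  by rewrite sN0 gt_eqF.
rewrite ltr_pdivrMr// -ltr_pdivrMl//.
by near: x; apply: nbhs_pinfty_gt; rewrite num_real.
Unshelve. all: by end_near. Qed.

(** The half-line is cut at [s], where [f] changes sign: the fundamental theorem
    of calculus on an unbounded interval is available for integrands of constant
    sign. *)
Let integral_half_line (h : R -> R) (A := `[0, s]%classic) (B := `[s, +oo[%classic) :
  continuous h -> (forall x, 0 <= h x) ->
  (\int[mu]_(x in `[0%R, +oo[) (h x)%:E =
   \int[mu]_(x in A) (h x)%:E + \int[mu]_(x in B) (h x)%:E)%E.
Proof.
move=> ch h0.
have mh : measurable_fun setT h by exact: continuous_measurable_fun.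
have -> : `[0, +oo[%classic = A `|` `]s, +oo[ :> set R.
  by rewrite /A -itv_bndbnd_setU ?bnd_simp// ltW.
rewrite ge0_integral_setU//=.
- congr (_ + _)%E; apply: integral_itv_obnd_cbnd.
  apply: measurable_funTS; exact: measurableT_comp.
- by rewrite /A; exact: measurable_itv.
- exact/measurable_EFinP/measurable_funTS.
- by move=> x _; rewrite lee_fin.
- apply/disj_setPS => x []; rewrite /A /= !in_itv/= => /andP[_ xs] /andP[].
  by rewrite ltNge xs.
Qed.

Let integral_sqr_half_line : (\int[mu]_(x in `[0%R, +oo[) (x ^+ 2 * g x)%:E =
  (s ^+ 2)%:E * \int[mu]_(x in `[0%R, +oo[) (g x)%:E)%E.
Proof.
pose h x := x ^+ 2 / s ^+ 2 * g x.
have hE x : h x = f x + g x by rewrite /h /f; ring.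
have g0 x : 0 <= g x by exact: normal_pdf_ge0.
have h0 x : 0 <= h x by rewrite mulr_ge0 ?divr_ge0 ?sqr_ge0.
have ch : continuous h.
  have -> : h = f \+ g by apply/funext.
  by move=> x; apply: cvgD; [exact: cf|exact: cg].
have mg : measurable_fun setT g by exact: continuous_measurable_fun.
have mf : measurable_fun setT f by exact: continuous_measurable_fun.
have mh : measurable_fun setT h by exact: continuous_measurable_fun.
have f0 x : s <= x -> 0 <= f x.
  move=> sx; rewrite mulr_ge0// subr_ge0 ler_pdivlMr ?exprn_gt0// mul1r.
  by rewrite ler_sqr// nnegrE ltW// (lt_le_trans s0).
transitivity ((s ^+ 2)%:E * \int[mu]_(x in `[0%R, +oo[) (h x)%:E)%E.
  rewrite -ge0_integralZl//; first last.
  - by rewrite lee_fin sqr_ge0.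
  - by move=> x _; rewrite lee_fin.
  - exact/measurable_EFinP/measurable_funTS.
  - apply: eq_integral => x _; rewrite -EFinM; congr EFin; rewrite /h.
    by field; exact: sN0.
congr (_ * _)%E; rewrite !integral_half_line//.
have intA (k : R -> R) : continuous k -> mu.-integrable `[0, s] (EFin \o k).
  move=> ck; apply: continuous_compact_integrable; first exact: segment_compact.
  exact: continuous_subspaceT.
have fA : (\int[mu]_(x in `[0%R, s]) (f x)%:E = (F s)%:E)%E.
  rewrite (@continuous_FTC2 _ f F)//.
  - by rewrite /F oppr0 mul0r sube0.
  - exact: continuous_subspaceT.
  - split => [x _| |]; first by have [] := is_derive_F x.
    + exact/cvg_at_right_filter/cF.
    + exact/cvg_at_left_filter/cF.
  - by move=> x _; rewrite derive1E; have [] := is_derive_F x.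
have fB : (\int[mu]_(x in `[s, +oo[) (f x)%:E = - (F s)%:E)%E.
  rewrite (@ge0_continuous_FTC2y _ f F s 0)//.
  - by rewrite sub0e.
  - exact: continuous_subspaceT.
  - by move=> x _; have [] := is_derive_F x.
  - exact/cvg_at_right_filter/cF.
  - by move=> x _; rewrite derive1E; have [] := is_derive_F x.
have hA : (\int[mu]_(x in `[0%R, s]) (h x)%:E =
    (F s)%:E + \int[mu]_(x in `[0%R, s]) (g x)%:E)%E.
  rewrite -fA -integralD_EFin//; [|exact: intA|exact: intA].
  by apply: eq_integral => x _; rewrite hE.
have hB : (\int[mu]_(x in `[s, +oo[) (h x)%:E =
    - (F s)%:E + \int[mu]_(x in `[s, +oo[) (g x)%:E)%E.
  rewrite -fB -ge0_integralD//.
  - by apply: eq_integral => x _; rewrite hE.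
  - by move=> x /=; rewrite in_itv/= andbT => sx; rewrite lee_fin f0.
  - exact/measurable_EFinP/measurable_funTS.
  - by move=> x _; rewrite lee_fin.
  - exact/measurable_EFinP/measurable_funTS.
by rewrite hA hB addeACA -EFinN -EFinD subrr add0e.
Qed.

Lemma integral_sqr_normal_pdf : (\int[mu]_x (x ^+ 2 * g x)%:E = (s ^+ 2)%:E)%E.
Proof.
have g0 x : 0 <= g x by exact: normal_pdf_ge0.
have gN : g =1 g \o -%R by move=> x; rewrite /= !gE sqrrN.
have cs : continuous (fun x : R => x ^+ 2 * g x).
  by move=> x; apply: cvgM; [exact: exprn_continuous|exact: cg].
rewrite ge0_symfun_integralT//.
- rewrite -set_itvcy integral_sqr_half_line muleCA set_itvcy -ge0_symfun_integralT//.
  by rewrite integral_normal_pdf mule1.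
- by move=> x; rewrite mulr_ge0 ?sqr_ge0.
- by move=> x /=; rewrite sqrrN [g x]gN.
Qed.

End normal_second_moment.

(** * Independence of the past and of future increments *)

Section independence.
Context {d : measure_display} {T : measurableType d} {R : realType}.
Variable P : probability T R.

Definition indep_event (E A : set T) : Prop :=
  measurable A /\ (P (A `&` E) = P A * P E)%E.

Lemma indep_event_dynkin E : measurable E -> dynkin (indep_event E).
Proof.
move=> mE; split.
- by split => //; rewrite setTI probability_setT mul1e.
- move=> A [mA AE]; split; first exact: measurableC.
  rewrite setIC -setDE measureD//; last by rewrite ltey_eq fin_num_measure.
  transitivity (P E - P A * P E)%E; first by congr (_ - _)%E; rewrite setIC; exact: AE.
  rewrite probability_setC// muleBl ?mul1e ?fin_num_measure//.
- move=> F tF FE; split; first by apply: bigcup_measurable => i _; have [] := FE i.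
  have mF i : measurable (F i) by have [] := FE i.
  rewrite setI_bigcupl measure_bigcup//; first last.
  + by apply: trivIset_setIr.
  + by move=> i _; exact: measurableI.
  rewrite measure_bigcup//.
  rewrite muleC -[X in (X * _)%E](@fineK _ (P E)) ?fin_num_measure// -nneseriesZl//.
  by apply: eq_eseriesr => i _; rewrite fineK ?fin_num_measure// muleC; have [] := FE i.
Qed.

(** The pi-lambda theorem: independence of an event passes from an
    intersection-stable class to the sigma-algebra it generates. *)
Lemma indep_event_sigma E G : measurable E -> setI_closed G ->
  G `<=` indep_event E -> <<s G >> `<=` indep_event E.
Proof.
move=> mE GI GE; rewrite -setI_closed_g_dynkin_g_sigma_algebra//.
by apply: smallest_sub => //; exact: indep_event_dynkin.
Qed.

(** The joint law agrees with the product of the two laws on rectangles, hence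
    everywhere, and the product of the coordinates is integrated by Fubini. *)
Lemma expectation_indep_mul (X Y : T -> R) :
  P.-integrable setT (EFin \o X) -> P.-integrable setT (EFin \o Y) ->
  (forall A B, measurable A -> measurable B ->
     P (X @^-1` A `&` Y @^-1` B) = (P (X @^-1` A) * P (Y @^-1` B))%E) ->
  P.-integrable setT (EFin \o (fun w => X w * Y w)) /\
  \int[P]_w (X w * Y w) = (\int[P]_w X w) * (\int[P]_w Y w).
Proof.
move=> iX iY XY.
have mX : measurable_fun setT X by apply/measurable_EFinP; exact: measurable_int iX.
have mY : measurable_fun setT Y by apply/measurable_EFinP; exact: measurable_int iY.
pose X' : {RV P >-> R} := mfun_Sub (mem_set mX : X \in mfun).
pose Y' : {RV P >-> R} := mfun_Sub (mem_set mY : Y \in mfun).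
pose phi w := (X w, Y w).
have mphi : measurable_fun setT phi by apply/measurable_fun_pairP; split.
pose m := pushforward P phi.
pose f (z : R * R) := (z.1 * z.2)%:E.
have mf : measurable_fun setT f.
  by apply/measurable_EFinP; apply: measurable_funM.
have mE (A : set (R * R)) : measurable A ->
    (distribution P X' \x distribution P Y')%E A = m A.
  by move=> mA; apply: product_measure_unique => // B C mB mC; rewrite -XY.
have intm (h : R * R -> \bar R) :
    (\int[distribution P X' \x distribution P Y']_z h z = \int[m]_z h z)%E.
  by apply: eq_measure_integral => A mA _; exact: mE.
have absfin (Z : {RV P >-> R}) : P.-integrable setT (EFin \o Z) ->
    (\int[distribution P Z]_x `|x%:E| \is a fin_num)%E.
  move=> iZ; rewrite ge0_integral_distribution//; last exact: measurableT_comp.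
  by apply: integrable_fin_num => //; exact: integrable_abse.
have f_int : (distribution P X' \x distribution P Y')%E.-integrable setT f.
  apply/integrable12ltyP => //.
  have inner (x : R) : (\int[distribution P Y']_y `|f (x, y)| =
      `|x%:E| * \int[distribution P Y']_y `|y%:E|)%E.
    rewrite -ge0_integralZl//; last exact: measurableT_comp.
    by apply: eq_integral => y _ /=; rewrite normrM EFinM.
  under eq_integral do rewrite inner.
  rewrite ge0_integralZr//; [|exact: measurableT_comp|exact: integral_ge0].
  by rewrite ltey_eq fin_numM// absfin.
have XY_int : P.-integrable setT (EFin \o (fun w => X w * Y w)).
  apply/integrableP; split; first by apply/measurable_EFinP; exact: measurable_funM.
  have /integrableP[_] := f_int; rewrite intm.
  rewrite ge0_integral_pushforward//; exact: measurableT_comp.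
split => //.
have dist (Z : {RV P >-> R}) : P.-integrable setT (EFin \o Z) ->
    (\int[distribution P Z]_x x%:E = \int[P]_w (Z w)%:E)%E.
  by move=> iZ; rewrite integral_distribution.
have distint (Z : {RV P >-> R}) : P.-integrable setT (EFin \o Z) ->
    (distribution P Z).-integrable setT (EFin \o id).
  move=> iZ; apply/integrableP; split; first exact: measurableT_comp.
  rewrite -ge0_fin_numE; [exact: absfin|exact: integral_ge0].
transitivity (fine (\int[m]_z f z)%E).
  by congr fine; rewrite /m integral_pushforward.
rewrite -intm -integral12_prod_meas1//= /fubini_F.
have inner (x : R) : (\int[distribution P Y']_y f (x, y) =
    x%:E * \int[distribution P Y']_y y%:E)%E.
  by rewrite -integralZl//; exact: (distint Y').
under eq_integral do rewrite inner.
have iYfin : (\int[distribution P Y']_y y%:E)%E \is a fin_num.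
  by apply: integrable_fin_num => //; exact: distint.
rewrite -(fineK iYfin) integralZr//; last exact: (distint X').
by rewrite fineM// ?(dist X')// ?(dist Y')//; apply: integrable_fin_num.
Qed.

End independence.

Section filtration_independence.
Context {d : measure_display} {T : measurableType d} {R : realType}.
Variables (P : probability T R) (W : R -> T -> R).
Hypothesis Pcomplete : measure_is_complete P.
Hypothesis Wwiener : two_sided_wiener P W.

Let mW t : measurable_fun setT (W t).
Proof. by case: Wwiener. Qed.

Lemma measurable_increment (D : set T) u v : measurable_fun D (increment W u v).
Proof. by apply: measurable_funTS; apply: measurable_funB. Qed.

Lemma measurable_increment_preimage u v B :
  measurable B -> measurable (increment W u v @^-1` B).
Proof.
by move=> mB; rewrite -[X in measurable X]setTI; exact: measurable_increment.
Qed.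

Section chain.
Variables (n : nat) (t : nat -> R).
Hypothesis t_mono : forall i, (i < n)%N -> t i <= t i.+1.

(** Rectangle events on consecutive increments. Increments between arbitrary
    times overlap, and it is only for consecutive ones that independence is
    postulated; those between two times of a chain are differences of sums of
    consecutive ones. *)
Definition chain_rectangles : set_system T :=
  [set A | exists2 B : nat -> set R, forall i, measurable (B i) &
     A = \bigcap_(i < n) increment W (t i) (t i.+1) @^-1` (B i)].

Lemma chain_rectangles_setI : setI_closed chain_rectangles.
Proof.
move=> _ _ [A mA ->] [B mB ->]; exists (fun i => A i `&` B i).
  by move=> i; exact: measurableI.
apply/seteqP; split => w /=.
  by move=> [wA wB] i ni; split; [exact: wA|exact: wB].
by move=> wAB; split => i ni; have [] := wAB i ni.
Qed.

Lemma chain_rectangles_measurable : chain_rectangles `<=` measurable.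
Proof.
move=> _ [B mB ->]; apply: bigcap_measurableType => i _.
exact: measurable_increment_preimage.
Qed.

(** Appending [b] to the chain makes the last increment one of a chain of
    independent increments. *)
Lemma chain_rectangles_indep b B : t n <= b -> measurable B ->
  chain_rectangles `<=` indep_event P (increment W (t n) b @^-1` B).
Proof.
move=> tnb mB A cA; split; first exact: chain_rectangles_measurable.
case: cA => B' mB' ->.
pose t' i := if (i <= n)%N then t i else b.
pose C i := if (i < n)%N then B' i else B.
have t'n i : (i < n)%N -> increment W (t' i) (t' i.+1) = increment W (t i) (t i.+1).
  by move=> ni; rewrite /t' (ltnW ni) ni.
have mono' i : (i < n.+1)%N -> t' i <= t' i.+1.
  rewrite ltnS leq_eqVlt => /orP[/eqP ->|ni]; first by rewrite /t' leqnn ltnn.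
  by rewrite /t' ni (ltnW ni); exact: t_mono.
have mC i : measurable (C i) by rewrite /C; case: ifP.
have [_ _ _ /(_ _ _ mono' _ mC) + _] := Wwiener.
rewrite big_ord_recr /=.
have -> : (\prod_(i < n) P (increment W (t' i) (t' i.+1) @^-1` C i) =
    P (\bigcap_(i < n) increment W (t i) (t i.+1) @^-1` B' i))%E.
  have [_ _ _ -> // _] := Wwiener.
  by apply: eq_bigr => i _; rewrite t'n// /C ltn_ord.
rewrite /C ltnn /t' leqnn ltnn => <-; congr (P _).
apply/seteqP; split => w /=.
  move=> [wB wn] i /= ni1.
  have /orP[/eqP ->|ni] : (i == n) || (i < n)%N by rewrite -leq_eqVlt.
    by rewrite ltnn leqnn.
  by rewrite ni (ltnW ni); exact: wB.
move=> wB; split; last by have := wB n (leqnn _); rewrite ltnn leqnn.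
by move=> i ni; have := wB i (ltnW ni); rewrite ni (ltnW ni).
Qed.

Lemma chain_increment_measurable i : (i <= n)%N ->
  measurable_fun setT (increment W (t 0) (t i) : g_sigma_algebraType chain_rectangles -> R).
Proof.
elim: i => [_|i IH ni].
  rewrite (_ : increment _ _ _ = cst 0); first exact: measurable_cst.
  by apply/funext => w; rewrite /increment subrr.
have -> : increment W (t 0) (t i.+1) =
    increment W (t 0) (t i) \+ increment W (t i) (t i.+1).
  by apply/funext => w; rewrite /increment /=; ring.
apply: measurable_funD; first by apply: IH; exact: ltnW.
move=> _ B mB; rewrite setTI; apply: sub_sigma_algebra.
exists (fun j => if j == i then B else setT); first by move=> j; case: ifP.
apply/seteqP; split => w /=; last by move=> /(_ i ni); rewrite /= eqxx.
by move=> wB j nj; case: eqP => //= ->.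
Qed.

End chain.

Definition finite_increments (l : seq R) : set_system T :=
  [set A | exists u v, [/\ u \in l, v \in l &
     exists2 B : set R, measurable B & A = increment W u v @^-1` B]].

(** Once sorted, the times of [l] form a chain that ends at [a], and the
    increments between them are measurable for its consecutive increments. *)
Lemma finite_increments_indep l a b B :
  (forall u, u \in l -> u <= a) -> a <= b -> measurable B ->
  <<s finite_increments l >> `<=` indep_event P (increment W a b @^-1` B).
Proof.
move=> la ab mB.
(* The default value [a] of [nth] closes the chain, at index [size l]. *)
pose s := sort <=%R l; pose t i := nth a s i; pose n := size l.
have sn : size s = n by rewrite size_sort.
have tn : t n = a by rewrite /t nth_default// sn.
have t_mono i : (i < n)%N -> t i <= t i.+1.
  move=> ni; have [ni'|] := ltnP i.+1 n; last first.
    move=> ni'; rewrite {2}/t nth_default ?sn//.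
    by apply: la; rewrite -(mem_sort <=%R) mem_nth// sn.
  apply: (sorted_leq_nth le_trans lexx) => //; rewrite ?inE ?sn//.
  by apply: sort_sorted; exact: le_total.
have tl u : u \in l -> exists2 i, (i < n)%N & t i = u.
  rewrite -(mem_sort <=%R) => us; exists (index u s).
    by rewrite -sn index_mem.
  by rewrite /t nth_index.
have mE : measurable (increment W a b @^-1` B) by exact: measurable_increment_preimage.
apply: (@subset_trans _ <<s chain_rectangles n t >>); last first.
  apply: indep_event_sigma => //; first exact: chain_rectangles_setI.
  by rewrite -tn; apply: chain_rectangles_indep; rewrite ?tn.
apply: smallest_sub; first exact: smallest_sigma_algebra.
move=> _ [u [v [/tl[i ni <-] /tl[j nj <-] [C mC ->]]]].
have -> : increment W (t i) (t j) =
    increment W (t 0) (t j) \- increment W (t 0) (t i).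
  by apply/funext => w; rewrite /increment /=; ring.
have := measurable_funB (@chain_increment_measurable n t j (ltnW nj))
   (@chain_increment_measurable n t i (ltnW ni)).
by move=> /(_ measurableT _ mC); rewrite setTI.
Qed.

Lemma negligible_diff_measure A B : measurable A -> measurable B ->
  P.-negligible (A `\` B) -> P.-negligible (B `\` A) -> P A = P B.
Proof.
have H C D : measurable C -> measurable D -> P.-negligible (C `\` D) ->
    (P C <= P D)%E.
  move=> mC mD CD; have CD0 : P (C `\` D) = 0%E.
    by apply/negligibleP => //; exact: measurableD.
  apply: (@le_trans _ _ (P (D `|` (C `\` D)))).
    apply: le_measure; rewrite ?inE//.
      by apply: measurableU => //; exact: measurableD.
    by move=> w Cw; have [Dw|Dw] := pselect (D w); [left|right].
  rewrite -[leRHS]adde0 -CD0; apply: measureU2 => //; exact: measurableD.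
by move=> mA mB AB BA; apply/eqP; rewrite eq_le !H.
Qed.

(** The union of the sigma-algebras of finite families of increments is not a
    sigma-algebra, but it is stable under intersection; so is its enlargement by
    null sets, which contains the generators of the filtration at time [a]. *)
Definition almost_finite_events (a : R) : set_system T :=
  [set A | exists l, [/\ forall u, u \in l -> u <= a & exists2 A0,
     <<s finite_increments l >> A0 &
     P.-negligible (A `\` A0) /\ P.-negligible (A0 `\` A)]].

Lemma finite_increments_sub l l' : {subset l <= l'} ->
  <<s finite_increments l >> `<=` <<s finite_increments l' >>.
Proof.
move=> ll; apply: sub_smallest2r; first exact: smallest_sigma_algebra.
move=> _ [u [v [ul vl [B mB ->]]]].
by exists u, v; split; [exact: ll|exact: ll|exists B].
Qed.

Lemma almost_finite_events_setI a : setI_closed (almost_finite_events a).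
Proof.
move=> A B [l [la [A0 A0l [N1 N2]]]] [k [ka [B0 B0k [M1 M2]]]].
exists (l ++ k); split.
  by move=> u; rewrite mem_cat => /orP[]; [exact: la|exact: ka].
exists (A0 `&` B0).
  apply: (@measurableI _ (g_sigma_algebraType (finite_increments (l ++ k)))).
    by apply: finite_increments_sub A0l => u; rewrite mem_cat => ->.
  by apply: finite_increments_sub B0k => u; rewrite mem_cat orbC => ->.
split.
  apply: negligibleS (negligibleU N1 M1) => w [[Aw Bw] /= /not_andP[]] H;
  by [left|right].
apply: negligibleS (negligibleU N2 M2) => w [[Aw Bw] /= /not_andP[]] H;
by [left|right].
Qed.

(** The generators involve finitely many times or are null, so that the
    approximating class suffices. Completeness of the measure makes the sets of
    the filtration measurable. *)
Lemma natural_filtration_indep a b A B : a <= b -> measurable B ->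
  natural_filtration P W a A -> indep_event P (increment W a b @^-1` B) A.
Proof.
move=> ab mB FA.
have mE : measurable (increment W a b @^-1` B) by exact: measurable_increment_preimage.
suff H : almost_finite_events a `<=` indep_event P (increment W a b @^-1` B).
  apply: (indep_event_sigma mE (@almost_finite_events_setI a) H).
  move: FA; apply: sub_smallest2r; first exact: smallest_sigma_algebra.
  move=> {}A [|NA]; last first.
    exists [::]; split => //; exists set0; first exact: sigma_algebra0.
    by rewrite setD0 set0D; split => //; exact: negligible_set0.
  move=> [u [v [vu ua [C mC ->]]]]; exists [:: u; v]; split.
    move=> x; rewrite !inE => /orP[] /eqP -> //; exact: le_trans vu ua.
  exists (increment W v u @^-1` C); last by rewrite setDv; split; exact: negligible_set0.
  by apply: sub_sigma_algebra; exists v, u; split; rewrite ?inE ?eqxx ?orbT//; exists C.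
move=> {FA}A [l [la [A0 A0l [N1 N2]]]].
have [mA0 A0E] := finite_increments_indep la ab mB A0l.
have mA : measurable A.
  have -> : A = (A0 `|` (A `\` A0)) `\` (A0 `\` A).
    apply/seteqP; split => w /=.
      by move=> Aw; split; [have [?|?] := pselect (A0 w); [left|right]|case].
    by move=> [[A0w|[]//] /not_andP[]// /contrapT].
  by apply: measurableD; [apply: measurableU => //|]; exact: Pcomplete.
split => //.
have -> : P A = P A0 by exact: negligible_diff_measure.
rewrite -A0E; apply: negligible_diff_measure; try exact: measurableI.
  by apply: negligibleS N1 => w [[Aw Ew] /not_andP[]].
by apply: negligibleS N2 => w [[Aw Ew] /not_andP[]].
Qed.

End filtration_independence.

(** * Adapted variables and moments of increments *)

Section normal_prob_integral.
Context {R : realType}.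
Notation mu := (@lebesgue_measure R).

(** The density is almost everywhere the Radon-Nikodym derivative of the normal
    law, for which the change of variables is known. *)
Lemma integral_normal_prob (m s : R) (f : R -> \bar R) :
  measurable_fun setT f -> (forall x, 0 <= f x)%E ->
  (\int[normal_prob m s]_x f x = \int[mu]_x (f x * (normal_pdf m s x)%:E))%E.
Proof.
move=> mf f0; have dom := @normal_prob_dominates R m s.
rewrite -(Radon_Nikodym_SigmaFinite.change_of_variables dom)//.
have mpdf : measurable_fun setT (fun x => (normal_pdf m s x)%:E).
  by apply/measurable_EFinP; exact: measurable_normal_pdf.
have iRN := Radon_Nikodym_SigmaFinite.f_integrable dom.
apply: ae_eq_integral => //.
- by apply: emeasurable_funM => //; exact: measurable_int iRN.
- exact: emeasurable_funM.
- apply: ae_eqe_mul2l; apply: integral_ae_eq => // E _ mE.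
  by rewrite -Radon_Nikodym_SigmaFinite.f_integral.
Qed.

End normal_prob_integral.

Section adapted.
Context {d : measure_display} {T : measurableType d} {R : realType}.
Variables (P : probability T R) (W : R -> T -> R).
Hypothesis Pcomplete : measure_is_complete P.
Hypothesis Wwiener : two_sided_wiener P W.
Implicit Types X Y Z : T -> R.

Local Notation adapted := (filtration_measurable P W).

Definition filtration_generators (t : R) : set_system T :=
  [set A | exists u v, [/\ v <= u, u <= t &
         exists2 B : set R, measurable B & A = increment W v u @^-1` B]]
  `|` P.-negligible.

Lemma adaptedP t X : adapted t X <->
  measurable_fun setT (X : g_sigma_algebraType (filtration_generators t) -> R).
Proof.
split=> [H _ B mB|H B mB]; first by rewrite setTI; exact: H.
by have := H measurableT B mB; rewrite setTI.
Qed.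

Lemma adapted_le s t X : s <= t -> adapted s X -> adapted t X.
Proof.
move=> st Xs B mB; have := Xs B mB; apply: sub_smallest2r.
  exact: smallest_sigma_algebra.
move=> A [[u [v [vu us AB]]]|NA]; [left|by right].
by exists u, v; split => //; exact: le_trans st.
Qed.

Lemma adapted_cst t (c : R) : adapted t (cst c).
Proof. by apply/adaptedP; exact: measurable_cst. Qed.

Lemma adaptedD t X Y : adapted t X -> adapted t Y -> adapted t (X \+ Y).
Proof. by rewrite !adaptedP; exact: measurable_funD. Qed.

Lemma adaptedM t X Y : adapted t X -> adapted t Y -> adapted t (X \* Y).
Proof. by rewrite !adaptedP; exact: measurable_funM. Qed.

Lemma adapted_increment t u v : v <= u -> u <= t -> adapted t (increment W v u).
Proof.
move=> vu ut B mB; apply: sub_sigma_algebra; left.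
by exists u, v; split => //; exists B.
Qed.

Lemma adapted_measurable t X : adapted t X -> measurable_fun setT X.
Proof.
move=> Xt _ B mB; rewrite setTI.
by have [] := natural_filtration_indep Pcomplete Wwiener (lexx t) measurableT (Xt B mB).
Qed.

Let increment_sqr_int a b : a <= b ->
  (\int[P]_w (increment W a b w ^+ 2)%:E = (b - a)%:E)%E.
Proof.
rewrite le_eqVlt => /orP[/eqP ->|ab].
  by rewrite subrr; apply: integral0_eq => w _; rewrite /increment subrr expr0n.
have mi : measurable_fun setT (increment W a b : T -> measurableTypeR R).
  exact: (measurable_increment Wwiener).
pose f (x : measurableTypeR R) := (x ^+ 2)%:E.
have mf : measurable_fun setT f by apply/measurable_EFinP; exact: measurable_funX.
have f0 x : (0 <= f x)%E by rewrite lee_fin sqr_ge0.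
transitivity (\int[pushforward P (increment W a b : T -> measurableTypeR R)]_x f x)%E.
  by rewrite ge0_integral_pushforward.
rewrite (eq_measure_integral (normal_prob 0 (Num.sqrt (b - a)))); last first.
  by move=> B mB _; have [_ _ /(_ _ _ ab B mB) + _ _] := Wwiener.
rewrite integral_normal_prob//.
transitivity ((Num.sqrt (b - a) ^+ 2)%:E); last by rewrite sqr_sqrtr// subr_ge0 ltW.
by rewrite -integral_sqr_normal_pdf ?sqrtr_gt0 ?subr_gt0.
Qed.

Lemma increment_L2 a b : a <= b -> L2 P (increment W a b).
Proof.
move=> ab; have mi := @measurable_increment _ _ _ _ _ Wwiener setT a b.
apply: L2_sqr => //; apply/integrableP; split.
  by apply/measurable_EFinP; exact: measurable_funX.
rewrite (eq_integral (fun w => (increment W a b w ^+ 2)%:E)).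
  by rewrite increment_sqr_int// ltry.
by move=> w _ /=; rewrite ger0_norm ?sqr_ge0.
Qed.

Lemma expectation_increment_sqr a b : a <= b ->
  \int[P]_w (increment W a b w ^+ 2) = b - a.
Proof. by move=> ab; rewrite /Rintegral increment_sqr_int. Qed.

Let adapted_increment_indep a b Z : a <= b -> adapted a Z ->
  forall A B, measurable A -> measurable B ->
  P (Z @^-1` A `&` increment W a b @^-1` B) =
  (P (Z @^-1` A) * P (increment W a b @^-1` B))%E.
Proof.
move=> ab Za A B mA mB.
by have [] := natural_filtration_indep Pcomplete Wwiener ab mB (Za A mA).
Qed.

Lemma adapted_increment_mul a b Z : a <= b -> adapted a Z ->
  P.-integrable setT (EFin \o Z) ->
  P.-integrable setT (EFin \o (fun w => Z w * increment W a b w)) /\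
  \int[P]_w (Z w * increment W a b w) =
    (\int[P]_w Z w) * (\int[P]_w increment W a b w).
Proof.
move=> ab Za iZ; apply: expectation_indep_mul => //.
  exact/L2_integrable/increment_L2.
exact: adapted_increment_indep.
Qed.

(** The second moment of an increment is the length of its interval, which is
    additive over two adjacent intervals of the same length: the product of the
    two means has to vanish, and the two laws coincide. *)
Lemma expectation_increment a b : a <= b -> \int[P]_w increment W a b w = 0.
Proof.
rewrite le_eqVlt => /orP[/eqP ->|ab].
  rewrite (_ : increment W b b = cst 0); first by rewrite Rintegral_cst// mul0r.
  by apply/funext => w; rewrite /increment subrr.
have law u v : u < v -> (\int[P]_w (increment W u v w)%:E =
    \int[normal_prob 0 (Num.sqrt (v - u))]_x x%:E)%E.
  move=> uv; have mi : measurable_fun setT (increment W u v : T -> measurableTypeR R).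
    exact: (measurable_increment Wwiener).
  rewrite (eq_measure_integral (pushforward P (increment W u v : T -> measurableTypeR R))); last first.
    by move=> B mB _; apply/esym; have [_ _ /(_ _ _ uv B mB) + _ _] := Wwiener.
  rewrite integral_pushforward//.
  exact/L2_integrable/increment_L2/ltW.
pose c := b + (b - a); have bc : b < c by rewrite /c; lra.
have cbab : \int[P]_w increment W b c w = \int[P]_w increment W a b w.
  have cb : c - b = b - a by rewrite /c; ring.
  by rewrite /Rintegral (law _ _ bc) (law _ _ ab) cb.
have := expectation_increment_sqr (ltW (lt_trans ab bc)).
have ab2 := increment_L2 (ltW ab); have bc2 := increment_L2 (ltW bc).
have -> : (fun w => increment W a c w ^+ 2) =
    (fun w => (increment W a b \+ increment W b c) w *
              (increment W a b \+ increment W b c) w).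
  by apply/funext => w; rewrite /increment /=; ring.
rewrite -/(ip P _ _) (ipDl ab2 bc2 (L2D ab2 bc2)) (ipDr ab2 bc2 ab2) (ipDr ab2 bc2 bc2).
rewrite (ipC _ (increment W b c) (increment W a b)) /ip.
have [_ ->] := adapted_increment_mul (ltW bc) (adapted_increment (ltW ab) (lexx b))
  (L2_integrable ab2).
have sq u v : u <= v -> \int[P]_w (increment W u v w * increment W u v w) = v - u.
  by move=> uv; rewrite -(expectation_increment_sqr uv).
rewrite cbab !sq ?(ltW ab)// ?(ltW bc)// /c.
move=> H; apply/eqP; rewrite -sqrf_eq0 expr2; apply/eqP.
move: H; set e := \int[P]_w _; lra.
Qed.

Lemma adapted_increment_mul0 a b Z : a <= b -> adapted a Z ->
  P.-integrable setT (EFin \o Z) ->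
  P.-integrable setT (EFin \o (fun w => Z w * increment W a b w)) /\
  \int[P]_w (Z w * increment W a b w) = 0.
Proof.
move=> ab Za iZ; have [? ->] := adapted_increment_mul ab Za iZ.
by rewrite expectation_increment// mulr0.
Qed.

Lemma adapted_increment_sqr a b Z : a <= b -> adapted a Z ->
  P.-integrable setT (EFin \o Z) ->
  P.-integrable setT (EFin \o (fun w => Z w * increment W a b w ^+ 2)) /\
  \int[P]_w (Z w * increment W a b w ^+ 2) = (\int[P]_w Z w) * (b - a).
Proof.
move=> ab Za iZ; rewrite -(expectation_increment_sqr ab).
apply: (expectation_indep_mul (Y := fun w => increment W a b w ^+ 2)) => //.
  exact/Lfun2_integrable_sqr/increment_L2.
move=> A B mA mB.
have mB2 : measurable ((fun x : R => x ^+ 2) @^-1` B).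
  by rewrite -[X in measurable X]setTI; exact: measurable_funX.
exact: (adapted_increment_indep ab Za mA mB2).
Qed.

End adapted.

(** * Elementary stochastic integrals *)

Section elementary_integrals.
Context {d : measure_display} {T : measurableType d} {R : realType}.
Variables (P : probability T R) (W : R -> T -> R).
Hypothesis Pcomplete : measure_is_complete P.
Hypothesis Wwiener : two_sided_wiener P W.
Implicit Types X Y Z : T -> R.
Notation mu := (@lebesgue_measure R).

Local Notation adapted := (filtration_measurable P W).

Definition bounded_fun X := exists C, forall w, `|X w| <= C.

Let bounded_mul X Y : bounded_fun X -> bounded_fun Y -> bounded_fun (X \* Y).
Proof.
move=> [C XC] [D YD]; exists (C * D) => w.
by rewrite /= normrM ler_pM.
Qed.

Let adapted_bounded_L2 t X Z : adapted t X -> bounded_fun X -> L2 P Z ->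
  L2 P (X \* Z).
Proof.
move=> Xt [C XC] Z2.
have -> : X \* Z = (fun w => Z w * X w) by apply/funext => w; exact: mulrC.
by apply: (L2_bounded_mul Z2 _ XC); exact: adapted_measurable Xt.
Qed.

(** The length of the intersection of [[a, b[] and [[a', b'[]. *)
Definition overlap (a b a' b' : R) : R :=
  Num.max 0 (Num.min b b' - Num.max a a').

Let increment_mul_disjoint a b a' b' c c' :
  a <= b -> a' <= b' -> b <= a' ->
  adapted a c -> adapted a' c' -> bounded_fun c -> bounded_fun c' ->
  ip P (c \* increment W a b) (c' \* increment W a' b') = 0.
Proof.
move=> ab ab' ba' ca ca' cb cb'.
have aa' : a <= a' by exact: le_trans ba'.
have i2 := increment_L2 Wwiener ab.
pose Z := (c' \* c) \* increment W a b.
have Za : adapted a' Z.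
  apply: adaptedM; last exact: adapted_increment.
  by apply: adaptedM => //; exact: adapted_le ca.
have Z2 : L2 P Z.
  apply: (@adapted_bounded_L2 a') => //; last exact: bounded_mul.
  by apply: adaptedM => //; exact: adapted_le ca.
have [_ <-] := adapted_increment_mul0 Pcomplete Wwiener ab' Za (L2_integrable Z2).
by apply: eq_Rintegral => w _; rewrite /Z /=; ring.
Qed.

Let increment_mul_le a b a' b' c c' : a <= b -> a' <= b' -> a <= a' ->
  adapted a c -> adapted a' c' -> bounded_fun c -> bounded_fun c' ->
  ip P (c \* increment W a b) (c' \* increment W a' b') =
  ip P c c' * overlap a b a' b'.
Proof.
move=> ab ab' aa' ca ca' cb cb'.
have [ba'|a'b] := leP b a'.
  rewrite increment_mul_disjoint// /overlap (max_r aa') max_l ?mulr0//.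
  by rewrite subr_le0 (le_trans _ ba')// ge_min lexx.
pose m := Num.min b b'.
have a'm : a' <= m by rewrite /m le_min (ltW a'b).
have mb : m <= b by rewrite /m ge_min lexx.
have mb' : m <= b' by rewrite /m ge_min lexx orbT.
have am : a <= m by exact: le_trans a'm.
have L u v : u <= v -> L2 P (increment W u v) by exact: increment_L2.
have cL Z : L2 P Z -> L2 P (c \* Z) by exact: adapted_bounded_L2 ca _.
have c'L Z : L2 P Z -> L2 P (c' \* Z) by exact: adapted_bounded_L2 ca' _.
(* Both increments are cut at the ends of the common interval [a', m]; one of
   the two pieces beyond [m] is empty. *)
have split1 : c \* increment W a b =
    (c \* increment W a a') \+ (c \* increment W a' m) \+ (c \* increment W m b).
  by apply/funext => w; rewrite /increment /=; ring.
have split2 : c' \* increment W a' b' =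
    (c' \* increment W a' m) \+ (c' \* increment W m b').
  by apply/funext => w; rewrite /increment /=; ring.
have mm : increment W m b = cst 0 \/ increment W m b' = cst 0.
  have empty u : increment W u u = cst 0.
    by apply/funext => w; rewrite /increment subrr.
  by rewrite /m; case: (leP b b') => _; [left|right].
have ov : overlap a b a' b' = m - a' by rewrite /overlap (max_r aa') max_r// subr_ge0.
have c'm : adapted m c' by exact: adapted_le ca'.
have cm : adapted m c by exact: adapted_le ca.
have ca'' : adapted a' c by exact: adapted_le ca.
have z1 : ip P (c \* increment W a a') (c' \* increment W a' b') = 0.
  exact: increment_mul_disjoint.
have z2 : ip P (c \* increment W a' m) (c' \* increment W m b') = 0.
  exact: increment_mul_disjoint.
have z3 : ip P (c \* increment W m b) (c' \* increment W a' m) = 0.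
  by rewrite ipC; exact: increment_mul_disjoint.
have z4 : ip P (c \* increment W m b) (c' \* increment W m b') = 0.
  by apply: ip_eq0 => w /=; case: mm => ->; rewrite /= !mulr0 ?mul0r.
have z5 : ip P (c \* increment W a' m) (c' \* increment W a' m) = ip P c c' * (m - a').
  have cc'2 : L2 P (c \* c').
    apply: cL; case: cb' => C Cc'; apply: L2_bounded Cc'.
    exact: adapted_measurable ca'.
  have [_ <-] := adapted_increment_sqr Pcomplete Wwiener a'm (adaptedM ca'' ca')
     (L2_integrable cc'2).
  by apply: eq_Rintegral => w _ /=; ring.
have [f1 f2 f3] : [/\ L2 P (c \* increment W a a'), L2 P (c \* increment W a' m) &
    L2 P (c \* increment W m b)] by split; apply: cL; exact: L.
have [g1 g2] : L2 P (c' \* increment W a' m) /\ L2 P (c' \* increment W m b').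
  by split; apply: c'L; exact: L.
have g0 : L2 P (c' \* increment W a' b') by apply: c'L; exact: L.
rewrite ov split1 (ipDl (L2D f1 f2) f3 g0) (ipDl f1 f2 g0) z1 add0r split2.
by rewrite (ipDr g1 g2 f2) (ipDr g1 g2 f3) z2 z3 z4 z5 !addr0.
Qed.

(** Cutting the increments at the ends of the common interval leaves one diagonal
    product and products over disjoint intervals, which vanish. As this holds for
    any two intervals, lists of terms need not be sorted, and sums and differences
    of elementary integrands require no common refinement. *)
Lemma increment_mul a b a' b' c c' : a <= b -> a' <= b' ->
  adapted a c -> adapted a' c' -> bounded_fun c -> bounded_fun c' ->
  ip P (c \* increment W a b) (c' \* increment W a' b') =
  ip P c c' * overlap a b a' b'.
Proof.
move=> ab ab' ca ca' cb cb'; have [aa'|/ltW a'a] := leP a a'.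
  exact: increment_mul_le.
rewrite ipC increment_mul_le// ipC /overlap; congr (_ * Num.max _ (_ - _)).
  exact: minC.
exact: maxC.
Qed.

(** A term [(a, b, c)] stands for the integrand equal to [c] on [[a, b[]. *)
Definition elementary_term : Type := R * R * (T -> R).

Definition elementary_ok (p : elementary_term) : Prop :=
  [/\ p.1.1 <= p.1.2, adapted p.1.1 p.2 & bounded_fun p.2].

Definition elementary_integral (l : seq elementary_term) (w : T) : R :=
  \sum_(p <- l) p.2 w * increment W p.1.1 p.1.2 w.

Definition elementary_fun (l : seq elementary_term) (u : R) (w : T) : R :=
  \sum_(p <- l) p.2 w * \1_`[p.1.1, p.1.2[ u.

Lemma elementary_term_L2 p : elementary_ok p -> L2 P (p.2 \* increment W p.1.1 p.1.2).
Proof.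
by move=> [ab pa pb]; apply: adapted_bounded_L2 pa pb _; exact: increment_L2.
Qed.

Let coef_L2 p : elementary_ok p -> L2 P p.2.
Proof.
by move=> [ab pa [C pC]]; apply: L2_bounded pC; exact: adapted_measurable pa.
Qed.

Lemma L2_sum (I : eqType) (l : seq I) (f : I -> T -> R) :
  (forall i, i \in l -> L2 P (f i)) -> L2 P (fun w => \sum_(i <- l) f i w).
Proof.
elim: l => [_|i l IH fL].
  by under eq_fun do rewrite big_nil; exact: L2_cst.
under eq_fun do rewrite big_cons; apply: L2D; first by apply: fL; rewrite mem_head.
by apply: IH => j jl; apply: fL; rewrite in_cons jl orbT.
Qed.

Lemma ip_suml (I : eqType) (l : seq I) (f : I -> T -> R) (g : T -> R) :
  (forall i, i \in l -> L2 P (f i)) -> L2 P g ->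
  ip P (fun w => \sum_(i <- l) f i w) g = \sum_(i <- l) ip P (f i) g.
Proof.
move=> + g2; elim: l => [_|i l IH fL].
  by rewrite big_nil; apply: ip_eq0 => w; rewrite big_nil mul0r.
have fl j : j \in l -> L2 P (f j) by move=> jl; apply: fL; rewrite in_cons jl orbT.
rewrite big_cons -IH// -ipDl//; [|by apply: fL; rewrite mem_head|exact: L2_sum].
by apply: eq_ip => // w; rewrite big_cons.
Qed.

Lemma ip_sum2 (I : eqType) (l : seq I) (f : I -> T -> R) :
  (forall i, i \in l -> L2 P (f i)) ->
  ip P (fun w => \sum_(i <- l) f i w) (fun w => \sum_(i <- l) f i w) =
  \sum_(i <- l) \sum_(j <- l) ip P (f i) (f j).
Proof.
move=> fL; rewrite ip_suml//; last exact: L2_sum.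
rewrite big_seq [RHS]big_seq; apply: eq_bigr => i il.
by rewrite ipC ip_suml//; [apply: eq_bigr => j _; rewrite ipC|exact: fL].
Qed.

Lemma elementary_integral_L2 l : (forall p, p \in l -> elementary_ok p) ->
  L2 P (elementary_integral l).
Proof. by move=> lok; apply: L2_sum => p /lok; exact: elementary_term_L2. Qed.

Lemma elementary_fun_L2 l u : (forall p, p \in l -> elementary_ok p) ->
  L2 P (elementary_fun l u).
Proof.
move=> lok; apply: L2_sum => p /lok pok.
under eq_fun do rewrite mulrC; exact/L2Z/coef_L2.
Qed.

Let overlap_measure a b a' b' :
  (\int[mu]_u (\1_`[a, b[ u * \1_`[a', b'[ u)%:E = (overlap a b a' b')%:E)%E.
Proof.
have capE : `[a, b[ `&` `[a', b'[ = `[Num.max a a', Num.min b b'[%classic :> set R.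
  apply/seteqP; split => x /=; rewrite !in_itv/= ge_max lt_min.
    by move=> [/andP[-> ->] /andP[-> ->]].
  by move=> /andP[/andP[-> ->] /andP[-> ->]].
rewrite (eq_integral (fun u : measurableTypeR R => (\1_(`[Num.max a a', Num.min b b'[%classic) u)%:E)); last first.
  by move=> u _; rewrite -capE indicI.
rewrite integral_indic// setIT /= lebesgue_measure_itv /overlap /= lte_fin.
case: ltP => [lt|ge]; first by move/ltW: lt; rewrite -subr_ge0 => /max_r ->.
by move: ge; rewrite -subr_le0 => /max_l ->.
Qed.

Let overlap_integrable a b a' b' :
  mu.-integrable setT (fun u => (\1_`[a, b[ u * \1_`[a', b'[ u)%:E).
Proof.
apply/integrableP; split.
  by apply/measurable_EFinP; apply: measurable_funM; exact: measurable_indic.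
rewrite (eq_integral (fun u : measurableTypeR R =>
    (\1_`[a, b[ u * \1_`[a', b'[ u)%:E)); first by rewrite overlap_measure ltry.
by move=> u _ /=; rewrite ger0_norm.
Qed.

(** Both sides are double sums over pairs of terms, which agree pair by pair: the
    length of the overlap of two intervals is also the integral of the product of
    their indicators. *)
Lemma elementary_isometry l : (forall p, p \in l -> elementary_ok p) ->
  (\int[mu]_u \int[P]_w (elementary_fun l u w ^+ 2)%:E =
   (ip P (elementary_integral l) (elementary_integral l))%:E)%E.
Proof.
move=> lok.
have inner u : (\int[P]_w (elementary_fun l u w ^+ 2)%:E =
    \sum_(p <- l) \sum_(q <- l)
      ((ip P p.2 q.2)%:E * (\1_`[p.1.1, p.1.2[ u * \1_`[q.1.1, q.1.2[ u)%:E))%E.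
  rewrite (eq_integral (fun w => (elementary_fun l u w * elementary_fun l u w)%:E)); last first.
    by move=> w _; rewrite expr2.
  have H : forall p, p \in l -> L2 P (fun w => p.2 w * \1_`[p.1.1, p.1.2[ u).
    by move=> p /lok pok; under eq_fun do rewrite mulrC; exact/L2Z/coef_L2.
  rewrite -ip_fin; [|exact: elementary_fun_L2|exact: elementary_fun_L2].
  rewrite ip_sum2// -sumEFin big_seq [RHS]big_seq; apply: eq_bigr => p pl.
  rewrite -sumEFin big_seq [RHS]big_seq; apply: eq_bigr => q ql.
  rewrite -EFinM; congr EFin.
  rewrite (@eq_ip _ _ _ P _ (fun w => \1_`[p.1.1, p.1.2[ u * p.2 w)
     _ (fun w => \1_`[q.1.1, q.1.2[ u * q.2 w)); try by move=> w; rewrite mulrC.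
  have p2 := coef_L2 (lok _ pl); have q2 := coef_L2 (lok _ ql).
  by rewrite ipZl// ?ipZr//; [rewrite mulrA mulrC|exact: L2Z].
under eq_integral do rewrite inner.
have int2 (p q : elementary_term) : mu.-integrable setT
   (fun u => (ip P p.2 q.2)%:E * (\1_`[p.1.1, p.1.2[ u * \1_`[q.1.1, q.1.2[ u)%:E)%E.
  by apply: integrableZl => //; exact: overlap_integrable.
rewrite integral_sum//; last by move=> p; apply: integrable_sum => // q _.
rewrite ip_sum2; last by move=> p /lok; exact: elementary_term_L2.
rewrite -sumEFin big_seq [RHS]big_seq; apply: eq_bigr => p pl.
rewrite integral_sum// -sumEFin big_seq [RHS]big_seq; apply: eq_bigr => q ql.
have [pab pa pb] := lok _ pl; have [qab qa qb] := lok _ ql.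
rewrite increment_mul// EFinM -overlap_measure.
by rewrite integralZl//; exact: overlap_integrable.
Qed.

End elementary_integrals.

(** * The norm of square-integrable processes *)

Section ito_integral.
Context {d : measure_display} {T : measurableType d} {R : realType}.
Variables (P : probability T R) (W : R -> T -> R).
Hypothesis Pcomplete : measure_is_complete P.
Hypothesis Wwiener : two_sided_wiener P W.
Implicit Types X Y Z : T -> R.
Notation mu := (@lebesgue_measure R).

Local Notation adapted := (filtration_measurable P W).

Definition jointly_measurable (s t : R) (F : R -> T -> R) : Prop :=
  measurable_fun (`[s, t] `*` setT) (fun p : R * T => F p.1 p.2).

Definition sqint (s t : R) (F : R -> T -> R) : \bar R :=
  (\int[mu]_(u in `[s, t]) \int[P]_w (F u w ^+ 2)%:E)%E.

Let sq_ge0 (F : R -> T -> R) u : (0 <= \int[P]_w (F u w ^+ 2)%:E)%E.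
Proof. by apply: integral_ge0 => w _; rewrite lee_fin sqr_ge0. Qed.

Lemma sqint_ge0 s t F : (0 <= sqint s t F)%E.
Proof. by apply: integral_ge0 => u _; exact: sq_ge0. Qed.

Let joint_section s t F u : jointly_measurable s t F -> u \in `[s, t] ->
  measurable_fun setT (F u).
Proof.
move=> mF ust.
have mI : measurable (`[s, t] `*` [set: T]) by apply: measurableX.
have mFt : measurable_fun setT
    ((fun p : R * T => F p.1 p.2) \_ (`[s, t] `*` setT)).
  by apply/(measurable_restrictT _ mI).
have := measurableT_comp mFt (@pair1_measurable _ _ _ _ u).
apply: eq_measurable_fun => w _ /=.
by rewrite patchE ifT// inE.
Qed.

Lemma measurable_fun_sq s t F : jointly_measurable s t F ->
  measurable_fun `[s, t] (fun u => (\int[P]_w (F u w ^+ 2)%:E)%E).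
Proof.
move=> mF.
have mI : measurable (`[s, t] `*` [set: T]) by apply: measurableX.
pose G := (fun p : R * T => F p.1 p.2) \_ (`[s, t] `*` setT).
have mG : measurable_fun setT (fun p => (G p ^+ 2)%:E).
  apply/measurable_EFinP/measurable_funX.
  by apply/(measurable_restrictT _ mI).
have H : measurable_fun setT (fubini_F P (fun p => (G p ^+ 2)%:E)).
  by apply: measurable_fun_fubini_tonelli_F => // p; rewrite lee_fin sqr_ge0.
apply: eq_measurable_fun (measurable_funTS H) => u; rewrite inE /= => ust.
by rewrite /fubini_F; apply: eq_integral => w _; rewrite /G patchE ifT// inE.
Qed.

(** The form in which the triangle inequality for the norm of square-integrable
    processes is used. *)
Lemma sqint_le s t (a b : R) (K F G : R -> T -> R) : 0 <= a -> 0 <= b ->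
  jointly_measurable s t K -> jointly_measurable s t F -> jointly_measurable s t G ->
  (forall u w, u \in `[s, t] -> K u w ^+ 2 <= a * F u w ^+ 2 + b * G u w ^+ 2) ->
  (sqint s t K <= a%:E * sqint s t F + b%:E * sqint s t G)%E.
Proof.
move=> a0 b0 mK mF mG KFG.
have msq H := measurable_fun_sq H.
rewrite /sqint -!ge0_integralZl//; try exact: msq; try by move=> u _; exact: sq_ge0.
rewrite -ge0_integralD//; first last.
- by apply: measurable_funeM; exact: msq.
- by move=> u _; apply: mule_ge0; rewrite ?lee_fin//; exact: sq_ge0.
- by apply: measurable_funeM; exact: msq.
- by move=> u _; apply: mule_ge0; rewrite ?lee_fin//; exact: sq_ge0.
apply: ge0_le_integral => //.
- exact: msq.
- by apply: emeasurable_funD; apply: measurable_funeM; exact: msq.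
move=> u ust.
have sec H (mH : jointly_measurable s t H) : measurable_fun setT (fun w => (H u w ^+ 2)%:E).
  by apply/measurable_EFinP/measurable_funX; exact: joint_section mH ust.
have nn (H : R -> T -> R) w : (0 <= (H u w ^+ 2)%:E)%E by rewrite lee_fin sqr_ge0.
rewrite -!ge0_integralZl//; try exact: sec.
rewrite -ge0_integralD//; first last.
- by apply: measurable_funeM; exact: sec.
- by move=> w _; apply: mule_ge0; rewrite ?lee_fin// sqr_ge0.
- by apply: measurable_funeM; exact: sec.
- by move=> w _; apply: mule_ge0; rewrite ?lee_fin// sqr_ge0.
apply: ge0_le_integral => //.
- exact: sec.
- by apply: emeasurable_funD; apply: measurable_funeM; exact: sec.
by move=> w _; rewrite -!EFinM -EFinD lee_fin KFG.
Qed.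

Lemma sqint_subset s r t F : r <= t -> jointly_measurable s t F ->
  (sqint s r F <= sqint s t F)%E.
Proof.
move=> rt mF; apply: ge0_subset_integral => //.
- exact: measurable_fun_sq.
- by apply: subset_itvl; rewrite bnd_simp.
Qed.

Definition step_terms (h : step_process) : seq (@elementary_term d T R) :=
  [seq (step_time h i, step_time h i.+1, step_coef h i) | i <- iota 0 (step_size h)].

Lemma step_integralE h : step_integral W h =1 elementary_integral W (step_terms h).
Proof.
move=> w; rewrite /step_integral /elementary_integral big_map /=.
by rewrite -(big_mkord xpredT (fun i => step_coef h i w * increment W (step_time h i) (step_time h i.+1) w))
  /index_iota subn0.
Qed.

Lemma step_funE h u : step_fun h u =1 elementary_fun (step_terms h) u.
Proof.
move=> w; rewrite /step_fun /elementary_fun big_map /=.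
by rewrite -(big_mkord xpredT (fun i => step_coef h i w * \1_`[step_time h i, step_time h i.+1[ u))
  /index_iota subn0.
Qed.

Lemma step_terms_ok s t h p : is_step_process P W s t h -> p \in step_terms h ->
  [/\ elementary_ok P W p, s <= p.1.1 & p.1.2 <= t].
Proof.
move=> [h0 hn hi] /mapP[i]; rewrite mem_iota add0n /= => ni ->.
have [ab ca cb] := hi i ni.
have up j : (j <= step_size h)%N -> s <= step_time h j.
  elim: j => [_|j IH jn]; first by rewrite h0.
  by have [+ _ _] := hi j jn; apply: le_trans; apply: IH; exact: ltnW.
have down k j : (j + k = step_size h)%N -> step_time h j <= t.
  elim: k j => [j|k IH j jk]; first by rewrite addn0 => ->; rewrite hn.
  have jn : (j < step_size h)%N by rewrite -jk addnS ltnS leq_addr.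
  have [+ _ _] := hi j jn; move=> /le_trans; apply; apply: IH.
  by rewrite addSnnS.
split; [by split|by apply: up; exact: ltnW|].
by apply: (down (step_size h - i.+1)%N); rewrite subnKC.
Qed.

Lemma elementary_fun_measurable (l : seq (@elementary_term d T R)) s t :
  (forall p, p \in l -> elementary_ok P W p) -> jointly_measurable s t (elementary_fun l).
Proof.
move=> lok; apply: measurable_funTS.
rewrite /elementary_fun; elim: l lok => [|p l IH] lok.
  by under eq_fun do rewrite big_nil; exact: measurable_cst.
under eq_fun do rewrite big_cons; apply: measurable_funD; last first.
  by apply: IH => q ql; apply: lok; rewrite in_cons ql orbT.
have [_ pa _] := lok p (mem_head _ _).
apply: measurable_funM.
  by apply: (measurableT_comp (f := p.2)) => //; exact: adapted_measurable pa.
have m1 : measurable_fun setT (\1_`[p.1.1, p.1.2[ : R -> R) by exact: measurable_indic.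
exact: (measurableT_comp m1 (@measurable_fst _ _ _ _)).
Qed.

Lemma elementary_fun_out (l : seq (@elementary_term d T R)) s t u w :
  (forall p, p \in l -> s <= p.1.1 /\ p.1.2 <= t) ->
  ~~ (s <= u < t) -> elementary_fun l u w = 0.
Proof.
move=> lst ust; rewrite /elementary_fun big_seq big1// => p /lst[sp pt].
rewrite indicE memNset ?mulr0//= in_itv/= => /andP[pu up].
by move/negP: ust; apply; rewrite (le_trans sp pu) (lt_le_trans up pt).
Qed.

Lemma elementary_sqint (l : seq (@elementary_term d T R)) s t :
  (forall p, p \in l -> [/\ elementary_ok P W p, s <= p.1.1 & p.1.2 <= t]) ->
  sqint s t (elementary_fun l) =
  (ip P (elementary_integral W l) (elementary_integral W l))%:E.
Proof.
move=> lst; rewrite -elementary_isometry//; last by move=> p /lst[].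
rewrite /sqint integral_mkcond; apply: eq_integral => u _.
rewrite patchE; case: ifPn => // ust.
apply/esym/integral0_eq => w _; rewrite (@elementary_fun_out l s t) ?expr0n//.
  by move=> p /lst[].
apply: contra ust => /andP[su ut]; rewrite inE /= in_itv/= su; exact: ltW.
Qed.

End ito_integral.

(** * Isometry and orthogonality of the Ito integral *)

Section ito_limits.
Context {d : measure_display} {T : measurableType d} {R : realType}.
Variables (P : probability T R) (W : R -> T -> R).
Hypothesis Pcomplete : measure_is_complete P.
Hypothesis Wwiener : two_sided_wiener P W.
Implicit Types X Y Z : T -> R.
Notation mu := (@lebesgue_measure R).

Local Notation adapted := (filtration_measurable P W).
Local Notation terms := (seq (@elementary_term d T R)).

(** What the proofs use of a stochastic integral: elementary integrands that
    converge to [H], with elementary integrals that converge to [I]. The squared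
    distances to [H] are given as real numbers, so that the arithmetic of limits
    applies to them. *)
Definition ito_approximation (s t : R) (H : R -> T -> R) (I : T -> R)
    (l : nat -> terms) (e : nat -> R) : Prop :=
  [/\ forall n p, p \in l n -> [/\ elementary_ok P W p, s <= p.1.1 & p.1.2 <= t],
      \forall n \near \oo, sqint P s t (fun u w => elementary_fun (l n) u w - H u w) = (e n)%:E,
      e n @[n --> \oo] --> 0 &
      ms_cvg P \oo (fun n => elementary_integral W (l n)) I].

Lemma ito_approximationP s t H I : is_ito_integral P W s t H I ->
  exists l e, ito_approximation s t H I l e.
Proof.
move=> [_ I2 [h [hok hH hI]]].
exists (fun n => step_terms (h n)); exists (fun n => fine (sqint P s t
   (fun u w => elementary_fun (step_terms (h n)) u w - H u w))).
have stepE n : sqint P s t (fun u w => elementary_fun (step_terms (h n)) u w - H u w) =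
    (\int[mu]_(u in `[s, t]) \int[P]_w ((step_fun (h n) u w - H u w) ^+ 2)%:E)%E.
  by apply: eq_integral => u _; apply: eq_integral => w _; rewrite step_funE.
split.
- by move=> n p pl; exact: step_terms_ok (hok n) pl.
- have [+ _] := (fine_cvgP _ _).1 hH; apply: filterS => n.
  by rewrite -stepE => /fineK.
- have [_] := (fine_cvgP _ _).1 hH; apply: cvg_trans; apply: near_eq_cvg.
  by apply: nearW => n /=; rewrite stepE.
- have [_] := (fine_cvgP _ _).1 hI; apply: cvg_trans; apply: near_eq_cvg.
  apply: nearW => n /=.
  have J2 : L2 P (elementary_integral W (step_terms (h n))).
    by apply: elementary_integral_L2 => // p /(step_terms_ok (hok n))[].
  rewrite (_ : (fun w => _) =
      EFin \o (elementary_integral W (step_terms (h n)) \- I)); last first.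
    by apply/funext => w /=; rewrite step_integralE.
  by rewrite LnormE//; exact: L2B.
Qed.

Section approximation.
Variables (s t : R) (H : R -> T -> R) (I : T -> R) (l : nat -> terms) (e : nat -> R).
Hypothesis lI : ito_approximation s t H I l e.

Lemma ito_approximation_ok n p : p \in l n -> elementary_ok P W p.
Proof. by have [lok _ _ _] := lI; move=> /lok[]. Qed.

Lemma ito_approximation_L2 n : L2 P (elementary_integral W (l n)).
Proof. by apply: elementary_integral_L2 => // p; exact: ito_approximation_ok. Qed.

End approximation.

(** Inequalities such as [(f + g)^2 <= (1 + c) f^2 + (1 + c^-1) g^2], for all
    [c > 0], pass to the limit when [g] tends to zero. They compare squared norms
    without a triangle inequality for their square roots. *)
Let limit_le (a b : nat -> R) (e : nat -> R) (a0 b0 : R) :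
  a n @[n --> \oo] --> a0 -> b n @[n --> \oo] --> b0 -> e n @[n --> \oo] --> 0 ->
  (forall c : R, 0 < c ->
     \forall n \near \oo, a n <= (1 + c) * b n + (1 + c^-1) * e n) ->
  0 <= b0 -> a0 <= b0.
Proof.
move=> aa bb ee H b00; apply/ler_addgt0Pr => eps eps0.
(* With this [c] the excess [c * b0] of the limit is at most [eps]. *)
pose c := eps / (b0 + 1).
have b1 : 0 < b0 + 1 by rewrite ltr_wpDl.
have c0 : 0 < c by rewrite divr_gt0.
have lim2 : (1 + c) * b n + (1 + c^-1) * e n @[n --> \oo] --> (1 + c) * b0 + (1 + c^-1) * 0.
  by apply: cvgD; apply: cvgM => //; exact: cvg_cst.
have : a0 <= (1 + c) * b0 + (1 + c^-1) * 0.
  by apply: ler_cvg_to aa lim2 _; exact: H.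
rewrite mulr0 addr0 => /le_trans; apply.
rewrite mulrDl mul1r lerD2l /c -mulrA ler_piMr ?(ltW eps0)//.
by rewrite mulrC ler_pdivrMr// mul1r lerDl.
Qed.

Let sq_split (c x y : R) : 0 < c ->
  (x + y) ^+ 2 <= (1 + c) * x ^+ 2 + (1 + c^-1) * y ^+ 2.
Proof.
move=> c0; rewrite -subr_ge0.
have -> : (1 + c) * x ^+ 2 + (1 + c^-1) * y ^+ 2 - (x + y) ^+ 2 =
    c^-1 * (c * x - y) ^+ 2 by field; rewrite gt_eqF.
by rewrite mulr_ge0 ?sqr_ge0// invr_ge0 ltW.
Qed.

(** The squared norms of the integrands and of the integrals, equal for the
    elementary approximations, converge to the two sides. *)
Lemma ito_isometry s t H I : is_ito_integral P W s t H I ->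
  (sqint P s t H = (ip P I I)%:E)%E.
Proof.
move=> HI; have [[mH _ Hfin] I2 _] := HI.
have [l [e lI]] := ito_approximationP HI.
have [lok el e0 JI] := lI.
have J2 := ito_approximation_L2 lI.
have JJ : ip P (elementary_integral W (l n)) (elementary_integral W (l n))
    @[n --> \oo] --> ip P I I by exact: ip_cvg.
have fin : sqint P s t H \is a fin_num.
  by rewrite ge0_fin_numE; [exact: Hfin|exact: sqint_ge0].
rewrite -(fineK fin); congr EFin; set b := fine _.
have b0 : 0 <= b by apply: fine_ge0; exact: sqint_ge0.
have mF n : jointly_measurable s t (elementary_fun (l n)).
  by apply: (elementary_fun_measurable Pcomplete Wwiener) => p /lok[].
have mD n : jointly_measurable s t (fun u w => elementary_fun (l n) u w - H u w).
  by apply: measurable_funB => //; exact: mF.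
have le1 (c : R) : 0 < c -> \forall n \near \oo,
    ip P (elementary_integral W (l n)) (elementary_integral W (l n)) <=
    (1 + c) * b + (1 + c^-1) * e n.
  move=> c0; apply: filterS el => n en.
  have c1 : 0 <= 1 + c by rewrite addr_ge0// ltW.
  have c2 : 0 <= 1 + c^-1 by rewrite addr_ge0// invr_ge0 ltW.
  rewrite -lee_fin -(elementary_sqint Pcomplete Wwiener (lok n))// EFinD !EFinM -en (fineK fin).
  apply: sqint_le => // u w _.
  by apply: le_trans (sq_split _ _ c0); rewrite addrC subrK.
have le2 (c : R) : 0 < c -> \forall n \near \oo, b <= (1 + c) *
    ip P (elementary_integral W (l n)) (elementary_integral W (l n)) +
    (1 + c^-1) * e n.
  move=> c0; apply: filterS el => n en.
  have c1 : 0 <= 1 + c by rewrite addr_ge0// ltW.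
  have c2 : 0 <= 1 + c^-1 by rewrite addr_ge0// invr_ge0 ltW.
  rewrite -lee_fin EFinD !EFinM -(elementary_sqint Pcomplete Wwiener (lok n))// -en (fineK fin).
  apply: sqint_le => // u w _.
  rewrite -(sqrrN (_ - _)); apply: le_trans (sq_split _ _ c0).
  by rewrite opprB addrC subrK.
apply/eqP; rewrite eq_le; apply/andP; split.
  exact: (limit_le (cvg_cst b) JJ e0 le2 (ip_ge0 _ _)).
exact: (limit_le JJ (cvg_cst b) e0 le1 b0).
Qed.

(** Cuts the integrand at time [r]. A term that starts after [r] keeps its
    starting time, to which its coefficient is adapted, and becomes empty. *)
Definition truncate (r : R) (p : @elementary_term d T R) : elementary_term :=
  (p.1.1, Num.max p.1.1 (Num.min p.1.2 r), p.2).

Lemma truncate_ok r p : elementary_ok P W p -> elementary_ok P W (truncate r p).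
Proof. by move=> [ab pa pb]; split => //=; rewrite le_max lexx. Qed.

Lemma elementary_fun_truncate r (l : terms) u w :
  elementary_fun (map (truncate r) l) u w = if u < r then elementary_fun l u w else 0.
Proof.
rewrite /elementary_fun big_map; case: ifPn => ur; last first.
  rewrite big1// => p _ /=; rewrite indicE memNset ?mulr0//= in_itv/=.
  move=> /andP[pu]; rewrite lt_max lt_min (negbTE ur) andbF orbF.
  by rewrite ltNge pu.
apply: eq_bigr => p _ /=; congr (_ * _); rewrite !indicE; congr (nat_of_bool _)%:R.
apply/idP/idP; rewrite !inE /= !in_itv/=.
  move=> /andP[pu]; rewrite lt_max lt_min => /orP[|/andP[up _]]; last by rewrite pu.
  by rewrite ltNge pu.
by move=> /andP[pu up]; rewrite pu lt_max lt_min up ur orbT.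
Qed.

(** What truncation removes is a sum of increments after [r], each multiplied by
    a coefficient known when the increment begins, as [Z] is. *)
Lemma ip_truncate r (l : terms) Z : (forall p, p \in l -> elementary_ok P W p) ->
  adapted r Z -> L2 P Z ->
  ip P Z (elementary_integral W (map (truncate r) l)) = ip P Z (elementary_integral W l).
Proof.
move=> lok Zr Z2; rewrite ipC [RHS]ipC.
have tL p : elementary_ok P W p -> L2 P (fun w => p.2 w * increment W p.1.1 p.1.2 w).
  exact: elementary_term_L2.
rewrite /elementary_integral; under eq_fun do rewrite big_map.
rewrite !ip_suml//; last 2 first.
- by move=> p /lok; exact: tL.
- by move=> p /lok /(truncate_ok r)/tL.
rewrite big_seq [RHS]big_seq; apply: eq_bigr => p /lok pok.
have [ab pa [C pC]] := pok; rewrite /truncate /=.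
have [br|rb] := leP p.1.2 r; first by rewrite max_r.
set b' := Num.max _ _.
have b'b : b' <= p.1.2 by rewrite ge_max ab ltW.
have ab' : p.1.1 <= b' by rewrite le_max lexx.
have rb' : r <= b' by rewrite le_max lexx orbT.
have Zp2 : L2 P (fun w => Z w * p.2 w).
  by apply: L2_bounded_mul Z2 _ pC; exact: adapted_measurable pa.
have Zpa : adapted b' (Z \* p.2).
  by apply: adaptedM; [exact: adapted_le Zr|exact: adapted_le pa].
have [_ zero] := adapted_increment_mul0 Pcomplete Wwiener b'b Zpa (L2_integrable Zp2).
apply/eqP; rewrite eq_sym -subr_eq0; apply/eqP.
rewrite -ipBl//; [|exact: tL|by apply: (tL (p.1.1, b', p.2)); split => //; exists C].
rewrite -[RHS]zero; apply: eq_Rintegral => w _; rewrite /increment /=; ring.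
Qed.

Lemma elementary_integral_adapted r (l : terms) :
  (forall p, p \in l -> elementary_ok P W p /\ p.1.2 <= r) ->
  adapted r (elementary_integral W l).
Proof.
rewrite /elementary_integral; elim: l => [_|p l IH lok].
  by under eq_fun do rewrite big_nil; exact: adapted_cst.
under eq_fun do rewrite big_cons; apply: adaptedD; last first.
  by apply: IH => q ql; apply: lok; rewrite in_cons ql orbT.
have [[ab pa _] br] := lok p (mem_head _ _).
apply: adaptedM; first by apply: adapted_le pa; exact: le_trans br.
exact: adapted_increment.
Qed.

Lemma elementary_integral_cat (l k : terms) w : elementary_integral W (l ++ k) w =
  elementary_integral W l w + elementary_integral W k w.
Proof. by rewrite /elementary_integral big_cat. Qed.

Definition opp_term (p : @elementary_term d T R) : elementary_term :=
  (p.1, fun w => - p.2 w).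

Lemma opp_term_ok p : elementary_ok P W p -> elementary_ok P W (opp_term p).
Proof.
move=> [ab pa [C pC]]; split => //=; last by exists C => w; rewrite normrN.
have := adaptedM (@adapted_cst _ _ _ P W p.1.1 (-1)) pa.
by rewrite (_ : _ \* _ = fun w => - p.2 w)//; apply/funext => w /=; rewrite mulN1r.
Qed.

Lemma elementary_integral_opp (l : terms) w :
  elementary_integral W (map opp_term l) w = - elementary_integral W l w.
Proof.
rewrite /elementary_integral big_map -sumrN; apply: eq_bigr => p _ /=.
by rewrite mulNr.
Qed.

Lemma elementary_fun_opp (l : terms) u w :
  elementary_fun (map opp_term l) u w = - elementary_fun l u w.
Proof.
rewrite /elementary_fun big_map -sumrN; apply: eq_bigr => p _ /=.
by rewrite mulNr.
Qed.

(** The integrals up to [r] and up to [t] come with unrelated approximations.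
    Cut at [r], those of the second approximate the same integrand on [[s, r]] as
    those of the first, and by isometry their integrals are close. *)
Lemma truncated_approximation_close s r t H Ir It l el k ek :
  s <= r -> r <= t -> jointly_measurable s t H ->
  ito_approximation s t H It l el -> ito_approximation s r H Ir k ek ->
  l2n P (elementary_integral W (map (truncate r) (l n)) \-
         elementary_integral W (k n)) @[n --> \oo] --> 0.
Proof.
move=> sr rt mH lI kI.
have [lok lel el0 _] := lI; have [kok kek ek0 _] := kI.
have lim0 : 2 * el n + 2 * ek n @[n --> \oo] --> (2 * 0 + 2 * 0 : R).
  by apply: cvgD; apply: cvgM => //; exact: cvg_cst.
have lim : Num.sqrt (2 * el n + 2 * ek n) @[n --> \oo] --> 0.
  rewrite mulr0 addr0 in lim0.
  by have := cvg_comp _ _ lim0 (@sqrt_continuous R 0); rewrite sqrtr0.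
apply/cvgrPdist_le => eps eps0.
have /cvgrPdist_le/(_ _ eps0) := lim.
apply: filterS3 lel kek => n elE ekE; rewrite !sub0r !normrN.
rewrite ger0_norm ?sqrtr_ge0// ger0_norm ?l2n_ge0//; apply: le_trans.
rewrite /l2n; apply: ler_wsqrtr.
pose q := map (truncate r) (l n) ++ map opp_term (k n).
have qok p : p \in q -> elementary_ok P W p.
  rewrite mem_cat => /orP[] /mapP[p' p'l ->].
    by apply: truncate_ok; have [] := lok n _ p'l.
  by apply: opp_term_ok; have [] := kok n _ p'l.
have -> : elementary_integral W (map (truncate r) (l n)) \- elementary_integral W (k n) =
    elementary_integral W q.
  by apply/funext => w; rewrite /q elementary_integral_cat elementary_integral_opp.
have qE u w : elementary_fun q u w =
    (if u < r then elementary_fun (l n) u w else 0) - elementary_fun (k n) u w.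
  by rewrite /elementary_fun big_cat /= -!/(elementary_fun _ u w)
    elementary_fun_opp elementary_fun_truncate.
have kout u w : ~~ (s <= u < r) -> elementary_fun (k n) u w = 0.
  by apply: elementary_fun_out => p /kok[].
have mF (m : terms) : (forall p, p \in m -> elementary_ok P W p) ->
    jointly_measurable s r (elementary_fun m).
  exact: (elementary_fun_measurable Pcomplete Wwiener).
have mHr : jointly_measurable s r H.
  apply: measurable_funS mH; first exact: measurableX.
  by apply: setSX => //; apply: subset_itvl; rewrite bnd_simp.
have mFl : jointly_measurable s r (elementary_fun (l n)) by apply: mF => p /lok[].
have mFk : jointly_measurable s r (elementary_fun (k n)) by apply: mF => p /kok[].
rewrite -lee_fin -(elementary_isometry Pcomplete Wwiener qok).
have -> : (\int[mu]_u \int[P]_w (elementary_fun q u w ^+ 2)%:E =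
    sqint P s r (elementary_fun q))%E.
  rewrite /sqint [RHS]integral_mkcond; apply: eq_integral => u _.
  rewrite patchE; case: ifPn => // usr.
  have {}usr : ~~ (s <= u <= r) by apply: contra usr => su; rewrite inE /= in_itv.
  apply: integral0_eq => w _; rewrite qE kout; last first.
    by apply: contra usr => /andP[-> /ltW].
  case: ifPn => [ur|_]; last by rewrite subrr expr0n.
  rewrite (@elementary_fun_out _ _ _ _ s t) ?subrr ?expr0n//.
    by move=> p /lok[].
  by apply: contra usr => /andP[-> _]; exact: ltW.
pose Dl u w := elementary_fun (l n) u w - H u w.
pose Dk u w := elementary_fun (k n) u w - H u w.
apply: (@le_trans _ _ (2%:E * sqint P s r Dl + 2%:E * sqint P s r Dk)%E).
  apply: sqint_le => //; try exact: measurable_funB; first exact: mF.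
  move=> u w _; rewrite qE /Dl /Dk; case: ifPn => ur.
    rewrite -subr_ge0; set x := elementary_fun (l n) u w; set y := elementary_fun (k n) u w.
    have -> : 2 * (x - H u w) ^+ 2 + 2 * (y - H u w) ^+ 2 - (x - y) ^+ 2 =
       (x + y - 2 * H u w) ^+ 2 by ring.
    exact: sqr_ge0.
  rewrite kout; last by rewrite (negbTE ur) andbF.
  by rewrite subrr expr0n /= addr_ge0// mulr_ge0// sqr_ge0.
rewrite (EFinD (2 * el n)) (EFinM 2 (el n)) (EFinM 2 (ek n)); apply: leeD; apply: lee_wpmul2l => //; last by rewrite ekE.
rewrite -elE; apply: sqint_subset => //.
by apply: measurable_funB => //; apply: (elementary_fun_measurable Pcomplete Wwiener) => p /lok[].
Qed.

(** The martingale property of the stochastic integral, in weak form: the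
    increment is approximated by the part after [r] of elementary integrals. *)
Lemma ito_orthogonal s r t H Ir It Z : s <= r -> r <= t ->
  is_ito_integral P W s r H Ir -> is_ito_integral P W s t H It ->
  L2 P Z -> adapted r Z -> ip P Z (It \- Ir) = 0.
Proof.
move=> sr rt HIr HIt Z2 Zr.
have [[mH _ _] It2 _] := HIt; have [_ Ir2 _] := HIr.
have [l [el lI]] := ito_approximationP HIt.
have [k [ek kI]] := ito_approximationP HIr.
have close := truncated_approximation_close sr rt mH lI kI.
have [_ _ _ cl] := lI; have [_ _ _ ck] := kI.
have l2 := ito_approximation_L2 lI; have k2 := ito_approximation_L2 kI.
pose J n := elementary_integral W (l n); pose K n := elementary_integral W (k n).
pose Jr n := elementary_integral W (map (truncate r) (l n)).
have Jr2 n : L2 P (Jr n).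
  apply: elementary_integral_L2 => // p /mapP[p' p'l ->]; apply: truncate_ok.
  exact: ito_approximation_ok lI _ _ p'l.
have lim : l2n P Z * (l2n P (J n \- It) + l2n P (Jr n \- K n) + l2n P (K n \- Ir))
    @[n --> \oo] --> (l2n P Z * (0 + 0 + 0) : R).
  by apply: cvgM; [exact: cvg_cst|apply: cvgD => //; apply: cvgD].
rewrite !addr0 mulr0 in lim.
apply/eqP; rewrite -normr_le0.
apply: (ler_cvg_to (cvg_cst _) lim); apply: nearW => n.
have -> : ip P Z (It \- Ir) = - ip P Z (J n \- It) + ip P Z (Jr n \- K n) +
    ip P Z (K n \- Ir).
  rewrite (ipBr It2 Ir2 Z2) (ipBr (l2 n) It2 Z2) (ipBr (Jr2 n) (k2 n) Z2).
  rewrite (ipBr (k2 n) Ir2 Z2) (_ : ip P Z (Jr n) = ip P Z (J n)); first by ring.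
  by apply: ip_truncate => // p; exact: ito_approximation_ok lI _ _.
rewrite !mulrDr (le_trans (ler_normD _ _))// lerD//; last first.
  exact: (ip_le_l2n Z2 (L2B (k2 n) Ir2)).
rewrite (le_trans (ler_normD _ _))// normrN lerD//.
  exact: (ip_le_l2n Z2 (L2B (l2 n) It2)).
exact: (ip_le_l2n Z2 (L2B (Jr2 n) (k2 n))).
Qed.

(** The integral up to [r] is orthogonal to the increment after [r]. *)
Lemma ito_increment_sqr s r t H Ir It : s <= r -> r <= t ->
  is_ito_integral P W s r H Ir -> is_ito_integral P W s t H It ->
  ip P (It \- Ir) (It \- Ir) = ip P It It - ip P Ir Ir.
Proof.
move=> sr rt HIr HIt; have [_ It2 _] := HIt; have [_ Ir2 _] := HIr.
have D2 := L2B It2 Ir2.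
suff IrD : ip P Ir (It \- Ir) = 0.
  have : ip P Ir It = ip P Ir Ir.
    by apply/eqP; rewrite -subr_eq0 -ipBr// IrD.
  by move=> E; rewrite ipBl// IrD subr0 ipBr// (ipC P It Ir) E.
(* [Ir] is a limit of elementary integrals, which are known at time [r]. *)
have [k [ek kI]] := ito_approximationP HIr; have [kok _ _ ck] := kI.
have k2 := ito_approximation_L2 kI.
have : ip P (elementary_integral W (k n)) (It \- Ir) @[n --> \oo] --> ip P Ir (It \- Ir).
  by apply: ip_cvg => //; exact: ms_cvg_cst.
under eq_fun => n.
  rewrite (ito_orthogonal sr rt HIr HIt (k2 n)); last first.
    by apply: elementary_integral_adapted => p /kok[].
  over.
by move=> /cvg_lim <-//; rewrite lim_cst.
Qed.

End ito_limits.

(** * Differential inequalities *)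

Section real_analysis.
Context {R : realType}.
Notation mu := (@lebesgue_measure R).

Lemma lebesgue_measure_oc (r t : R) : r <= t -> fine (mu `]r, t]) = t - r.
Proof.
rewrite le_eqVlt => /orP[/eqP ->|rt]; rewrite lebesgue_measure_itv /= lte_fin.
  by rewrite ltxx subrr.
by rewrite rt -EFinB.
Qed.

(** Integral representations of the increments of [f] by integrands that tend
    to [c] near [p], uniformly in the end points, make [f] differentiable: the
    integrands may change with the interval. *)
Lemma is_derive_increment (f : R -> R) (K : R -> R -> R -> R) (s p c : R) :
  s < p ->
  (forall r t, s <= r -> r <= t -> mu.-integrable `]r, t] (EFin \o K r t)) ->
  (forall r t, s <= r -> r <= t -> f t - f r = \int[mu]_(u in `]r, t]) K r t u) ->
  K z.1.1 z.1.2 z.2 @[z --> ((p, p), p)] --> c ->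
  is_derive p 1 f c.
Proof.
move=> sp iK fK Kc.
suff lim : (fun h : R => h^-1 *: (f (h *: 1 + p) - f p)) @ 0^' --> c.
  split; first by apply/cvg_ex; exists c.
  exact/cvg_lim.
apply/cvgrPdist_le => eps eps0.
have /cvgrPdist_le/(_ _ eps0)/nbhs_ballP[del /= del0 Kdel] := Kc.
have close r t : s <= r -> r <= t -> ball p del r -> ball p del t ->
    `|(f t - f r) - c * (t - r)| <= eps * (t - r).
  move=> sr rt pr pt; rewrite fK//.
  have icst (k : R) : mu.-integrable `]r, t] (EFin \o cst k).
    apply: measurable_bounded_integrable => //.
      by rewrite /= lebesgue_measure_itv /=; case: ifP => // _; rewrite -EFinB ltry.
    by exists `|k|; split; [exact: num_real|move=> x kx u _ /=; exact: ltW].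
  have cstE (k : R) : \int[mu]_(u in `]r, t]) k = k * (t - r).
    by rewrite Rintegral_cst// lebesgue_measure_oc.
  rewrite -cstE -RintegralB//; [|exact: iK|exact: icst].
  have iKc : mu.-integrable `]r, t] (EFin \o (fun u => K r t u - c)).
    rewrite (_ : _ \o _ = (EFin \o K r t) \- (EFin \o cst c))%E; last exact/funext.
    by apply: integrableB; [|exact: iK|exact: icst].
  apply: le_trans (le_normr_Rintegral _ iKc) _ => //.
  rewrite -cstE; apply: le_Rintegral => //; [|exact: icst|].
    exact: integrable_norm.
  move=> u; rewrite /= in_itv/= => /andP[ru ut].
  rewrite distrC; apply: (Kdel ((r, t), u)); split; first by split.
  move: pr pt; rewrite /ball /= !ltr_distlC => /andP[? ?] /andP[? ?].
  by apply/andP; split; lra.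
near=> h.
have h0 : h != 0 by near: h; exact: nbhs_dnbhs_neq.
have hdel : `|h| < Num.min del (p - s).
  near: h; apply: dnbhs0_lt; rewrite lt_min del0/= subr_gt0//.
move: hdel; rewrite lt_min => /andP[hdel hps].
have pdel : ball p del p by exact: ballxx.
have phdel : ball p del (p + h).
  by rewrite /ball /= opprD addrA subrr sub0r normrN.
rewrite -[h *: 1]/(h * 1) mulr1 (addrC h) -[_ *: _]/(_ * _).
have -> : c - h^-1 * (f (p + h) - f p) = - (h^-1 * ((f (p + h) - f p) - c * h)).
  by field.
rewrite normrN normrM normfV -ler_pdivlMl ?invr_gt0 ?normr_gt0// invrK [leRHS]mulrC.
have [hp|hn] := ltP 0 h.
  have := @close p (p + h) (ltW sp) _ pdel phdel.
  rewrite (_ : p + h - p = h) ?(gtr0_norm hp); last by ring.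
  by apply; rewrite lerDl ltW.
have := @close (p + h) p _ _ phdel pdel.
have -> : f p - f (p + h) - c * (p - (p + h)) = - (f (p + h) - f p - c * h) by ring.
rewrite normrN (ler0_norm hn) (_ : p - (p + h) = - h); last by ring.
apply; last by rewrite gerDl.
by move: hps; rewrite (ler0_norm hn); lra.
Unshelve. all: by end_near. Qed.

Lemma le_of_derive_le0 (f df : R -> R) (s t : R) : s <= t -> continuous f ->
  (forall u, s < u -> is_derive u 1 f (df u)) -> (forall u, s < u -> df u <= 0) ->
  f t <= f s.
Proof.
rewrite le_eqVlt => /orP[/eqP -> //|st] cf fdf df0.
have [||c] := @MVT _ f df s t st.
- by move=> x; rewrite in_itv/= => /andP[sx _]; exact: fdf.
- exact: continuous_subspaceT.
rewrite in_itv/= => /andP[sc _] E; rewrite -subr_le0 E.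
by rewrite mulr_le0_ge0 ?df0// subr_ge0 ltW.
Qed.

Lemma is_derive_expR_shift (k s u : R) :
  is_derive u 1 (fun t => expR (k * (t - s))) (k * expR (k * (u - s))).
Proof.
have H1 : is_derive u 1 (fun t : R => k * (t - s)) k.
  by apply: is_derive_eq; rewrite /GRing.scale /=; ring.
by rewrite mulrC; exact: (@is_derive1_comp _ expR (fun t => k * (t - s))).
Qed.

Lemma continuous_expR_shift (k s : R) : continuous (fun t => expR (k * (t - s))).
Proof.
move=> u; apply: (@continuous_comp _ _ _ (fun t => k * (t - s)) expR).
  apply: cvgM; first exact: cvg_cst.
  by apply: cvgB => //; exact: cvg_cst.
exact: continuous_expR.
Qed.

(** First [m1^2 exp (- 2 (alpha + 1) t)] decreases; with the resulting bound on
    [m1^2] in the equation of [m2], so does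
    [m2 exp (- (2 alpha + 1) t) - 2 m1(s)^2 exp t], for times counted from [s]. *)
Lemma moment_equations_decay (alpha s : R) (m1 m2 : R -> R) :
  continuous m1 -> continuous m2 -> (forall u, 0 <= m2 u) ->
  (forall u, s < u -> is_derive u 1 m1 ((alpha + 1 - m2 u) * m1 u)) ->
  (forall u, s < u -> is_derive u 1 m2
     ((2 * alpha + 1) * m2 u + 2 * m1 u ^+ 2 - 2 * m2 u ^+ 2)) ->
  m1 s ^+ 2 <= m2 s ->
  forall t, s <= t -> m2 t <= 3 * m2 s * expR (2 * (alpha + 1) * (t - s)).
Proof.
move=> c1 c2 m20 d1 d2 m12.
have m1_decay t : s <= t ->
    m1 t ^+ 2 <= m1 s ^+ 2 * expR (2 * (alpha + 1) * (t - s)).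
  move=> st; pose k := - (2 * (alpha + 1)).
  pose f u := m1 u ^+ 2 * expR (k * (u - s)).
  have : f t <= f s.
    apply: (@le_of_derive_le0 f (fun u => - 2 * m2 u * (m1 u ^+ 2 * expR (k * (u - s))))) => //.
    - move=> u; apply: cvgM; last exact: continuous_expR_shift.
      by apply: cvgM; exact: c1.
    - move=> u su; have := d1 _ su; have := is_derive_expR_shift k s u => e1 e2.
      rewrite /f; apply: is_derive_eq; rewrite /GRing.scale /= /k; ring.
    - move=> u su; apply: mulr_le0_ge0; first by rewrite mulNr oppr_le0 mulr_ge0.
      by apply: mulr_ge0; rewrite ?sqr_ge0 ?expR_ge0.
  rewrite /f /= subrr mulr0 expR0 mulr1 /k mulNr expRN.
  by rewrite ler_pdivrMr ?expR_gt0.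
move=> t st.
pose k := - (2 * alpha + 1).
pose f u := m2 u * expR (k * (u - s)) - 2 * m1 s ^+ 2 * expR (1 * (u - s)).
have : f t <= f s.
  apply: (@le_of_derive_le0 f (fun u => (2 * m1 u ^+ 2 - 2 * m2 u ^+ 2) * expR (k * (u - s))
     - 2 * m1 s ^+ 2 * expR (1 * (u - s)))) => //.
  - move=> u; apply: cvgB; apply: cvgM; try exact: continuous_expR_shift; first exact: c2.
    exact: cvg_cst.
  - move=> u su; have := d2 _ su; have := is_derive_expR_shift k s u.
    have := is_derive_expR_shift 1 s u => e1 e2 e3.
    rewrite /f; apply: is_derive_eq; rewrite /GRing.scale /= /k; ring.
  - move=> u su; rewrite subr_le0.
    apply: (@le_trans _ _ (2 * m1 u ^+ 2 * expR (k * (u - s)))).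
      by rewrite ler_wpM2r ?expR_ge0// gerDl oppr_le0 mulr_ge0// sqr_ge0.
    rewrite -(mulrA 2) -(mulrA 2 (m1 s ^+ 2)) ler_wpM2l//.
    apply: le_trans (ler_wpM2r (expR_ge0 _) (m1_decay _ (ltW su))) _.
    rewrite -(mulrA (m1 s ^+ 2)) -expRD ler_wpM2l ?sqr_ge0// ler_expR /k.
    by rewrite le_eqVlt; apply/orP; left; apply/eqP; ring.
rewrite /f /= subrr !mulr0 expR0 !mulr1 mul1r /k mulNr expRN.
set E := expR _; set e := expR _ => fts.
have e1 : 1 <= e by rewrite -expR0 ler_expR subr_ge0.
have E0 : 0 < E by exact: expR_gt0.
have -> : expR (2 * (alpha + 1) * (t - s)) = E * e.
  by rewrite /E /e -expRD; congr expR; ring.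
have m2t : m2 t <= (m2 s + 2 * m1 s ^+ 2 * (e - 1)) * E.
  rewrite -ler_pdivrMr//; move: fts; rewrite lerBlDr => /le_trans; apply.
  by rewrite le_eqVlt; apply/orP; left; apply/eqP; ring.
apply: le_trans m2t _.
rewrite (_ : 3 * m2 s * (E * e) = 3 * m2 s * e * E); last by ring.
rewrite ler_wpM2r ?(ltW E0)//.
have h1 : 2 * m1 s ^+ 2 * (e - 1) <= 2 * m2 s * (e - 1).
  by rewrite ler_wpM2r ?subr_ge0// ler_wpM2l.
have h2 : m2 s * 1 <= m2 s * e by rewrite ler_wpM2l.
nra.
Qed.

End real_analysis.

(** * The moments of a solution *)

Section fubini_drift.
Context {d : measure_display} {T : measurableType d} {R : realType}.
Variable P : probability T R.
Notation mu := (@lebesgue_measure R).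

(** Fubini for the pairing of a variable with a pathwise time integral. The
    pathwise integral is not known to be measurable: it only has to agree
    almost surely with a square-integrable variable. *)
Lemma ip_time_integral (s t : R) (G : R -> T -> R) (V Z : T -> R) :
  L2 P Z -> L2 P V -> (forall u, L2 P (G u)) ->
  measurable_fun setT (fun p : R * T => G p.1 p.2) ->
  continuous (fun u => ip P (G u) (G u)) ->
  {ae P, forall w, V w = \int[mu]_(u in `[s, t]) G u w} ->
  ip P Z V = \int[mu]_(u in `[s, t]) ip P Z (G u).
Proof.
move=> Z2 V2 G2 mG cG VG.
pose F (p : measurableTypeR R * T) := (Z p.2 * G p.1 p.2 * \1_`[s, t] p.1)%:E.
have mF : measurable_fun setT F.
  apply/measurable_EFinP; apply: measurable_funM.
    apply: measurable_funM; last exact: mG.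
    exact: (measurableT_comp (L2_measurable Z2) (@measurable_snd _ _ _ _)).
  have m1 : measurable_fun setT (\1_`[s, t] : measurableTypeR R -> R) by exact: measurable_indic.
  exact: (measurableT_comp m1 (@measurable_fst _ _ _ _)).
pose k u := (ip P Z Z + ip P (G u) (G u)).
have ck : continuous k by move=> u; apply: cvgD; [exact: cvg_cst|exact: cG].
have iF : (mu \x P)%E.-integrable setT F.
  apply/integrable12ltyP => //.
  have bound u : (\int[P]_w `|F (u, w)| <= (k u * \1_`[s, t] u)%:E)%E.
    have msq (f : T -> R) : L2 P f -> measurable_fun setT (fun w => (f w * f w)%:E).
      move=> f2; apply/measurable_EFinP.
      by apply: measurable_funM; exact: L2_measurable f2.
    have sq0 (f : T -> R) w : (0 <= (f w * f w)%:E)%E by rewrite lee_fin -expr2 sqr_ge0.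
    have mZG := emeasurable_funD (msq _ Z2) (msq _ (G2 u)).
    rewrite EFinM /k EFinD (ip_fin Z2 Z2) (ip_fin (G2 u) (G2 u)).
    rewrite -(ge0_integralD _ measurableT (fun w _ => sq0 Z w) (msq _ Z2)
      (fun w _ => sq0 (G u) w) (msq _ (G2 u))).
    rewrite -ge0_integralZr//; last by move=> w _; rewrite adde_ge0.
    apply: ge0_le_integral => //.
    - by apply: measurableT_comp => //; exact: (measurableT_comp mF (@pair1_measurable _ _ _ _ u)).
    - exact: emeasurable_funM.
    move=> w _; rewrite /F /= -EFinD -EFinM lee_fin normrM (ger0_norm (x := \1__ _))//.
    rewrite ler_wpM2r// ler_norml; apply/andP; split; nra.
  apply: (@le_lt_trans _ _ (\int[mu]_u (k u * \1_`[s, t] u)%:E)%E).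
    apply: ge0_le_integral => //.
    - by move=> u _; exact: integral_ge0.
    - have mabs : measurable_fun setT (fubini_F P (abse \o F)).
        have mF' : measurable_fun setT (abse \o F) by exact: measurableT_comp.
        apply: (measurable_fun_fubini_tonelli_F _ mF'); by move=> x; exact: abse_ge0.
      exact: mabs.
    - apply/measurable_EFinP; apply: measurable_funM; first exact: continuous_measurable_fun.
      exact: measurable_indic.
  rewrite (_ : (\int[mu]_u _)%E = (\int[mu]_(u in `[s, t]) (k u)%:E)%E).
    apply: integrable_lty => //; apply: continuous_compact_integrable.
      exact: segment_compact.
    exact: continuous_subspaceT.
  rewrite [RHS]integral_mkcond; apply: eq_integral => u _.
  by rewrite patchE indicE; case: ifPn => _; rewrite ?mulr1 ?mulr0.
rewrite /ip /Rintegral; congr fine.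
transitivity (\int[P]_w \int[mu]_u F (u, w))%E.
  apply: ae_eq_integral => //.
  - apply/measurable_EFinP; apply: measurable_funM.
      exact: (L2_measurable Z2).
    exact: (L2_measurable V2).
  - exact: (measurable_fubini_G iF).
  - have := ae_integrable2 iF; apply: filterS2 VG => w Vw iw _.
    have FE : (\int[mu]_u F (u, w) = \int[mu]_(u in `[s, t]) (Z w * G u w)%:E)%E.
      rewrite [RHS]integral_mkcond; apply: eq_integral => u _.
      by rewrite patchE /F /= indicE; case: ifPn => _; rewrite ?mulr1 ?mulr0.
    rewrite FE; have [->|Zw] := eqVneq (Z w) 0.
      by under eq_integral do rewrite mul0r; rewrite mul0r integral0.
    have iZG : mu.-integrable `[s, t] (fun u => (Z w * G u w)%:E).
      apply/integrable_mkcond => //; apply: eq_integrable iw => // u _.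
      by rewrite patchE /F /= indicE; case: ifPn => _; rewrite ?mulr1 ?mulr0.
    have iG : mu.-integrable `[s, t] (EFin \o (G ^~ w)).
      have := integrableZl _ (Z w)^-1 iZG; move=> /(_ _) h.
      apply: eq_integrable (h _) => // u _.
      by rewrite -EFinM mulrA mulVf// mul1r.
    rewrite Vw EFinM fineK; last exact: integrable_fin_num.
    by rewrite -integralZl.
rewrite -Fubini//; rewrite [RHS]integral_mkcond; apply: eq_integral => u _.
rewrite patchE /F /=; case: ifPn => us.
  rewrite fineK; last by apply: integrable_fin_num => //; exact: L2_ip_integrable.
  by apply: eq_integral => w _; rewrite indicE us mulr1.
by apply: integral0_eq => w _; rewrite indicE (negbTE us) mulr0.
Qed.

End fubini_drift.

Section solution_moments.
Context {d : measure_display} {T : measurableType d} {R : realType}.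
Variables (P : probability T R) (W : R -> T -> R).
Hypothesis Pcomplete : measure_is_complete P.
Hypothesis Wwiener : two_sided_wiener P W.
Notation mu := (@lebesgue_measure R).
Variables (alpha s : R) (X : T -> R) (Y : R -> T -> R).
Hypothesis X2 : L2 P X.
Hypothesis HY : mf_solution P W alpha s X Y.

Local Notation adapted := (filtration_measurable P W).

(** Frozen at its initial value before time [s], the solution becomes a
    mean-square continuous process on the whole line. *)
Let y (u : R) : T -> R := Y (Num.max s u).

Let yE u : s <= u -> y u = Y u. Proof. by move=> su; rewrite /y max_r. Qed.

Let s_max u : s <= Num.max s u. Proof. by rewrite le_max lexx. Qed.

Let y2 u : L2 P (y u). Proof. exact: mf_square_integrable HY _ (s_max u). Qed.

Let y_adapted u : s <= u -> adapted u (y u).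
Proof. by move=> su; rewrite yE//; exact: mf_adapted HY _ su. Qed.

Let max_continuous : continuous (fun u : R => Num.max s u).
Proof. by move=> u; apply: continuous_max; [exact: cvg_cst|exact: cvg_id]. Qed.

Let y_ms_continuous t : ms_cvg P (nbhs t) y (y t).
Proof.
have H := mf_continuous HY (s_max t).
have lim : Num.max s u @[u --> t] --> within `[s, +oo[ (nbhs (Num.max s t)).
  move=> A nA; have nB : \forall u \near t, `[s, +oo[%classic (Num.max s u) -> A (Num.max s u).
    exact: (@max_continuous t _ nA).
  by apply: filterS nB => u; apply; rewrite /= in_itv/= s_max.
have {}H := cvg_comp _ _ lim H; have [_] := (fine_cvgP _ _).1 H.
apply: cvg_trans; apply: near_eq_cvg; apply: nearW => u /=.
rewrite (_ : (fun w => _) = EFin \o (y u \- y t)); last exact/funext.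
by rewrite LnormE//; exact: L2B.
Qed.

Let m1 u : R := ip P (cst 1) (y u).
Let m2 u : R := ip P (y u) (y u).

Let m1_continuous : continuous m1.
Proof.
have c2 : L2 P (cst 1) by exact: L2_cst.
move=> t; have yt := @y_ms_continuous t.
have ct : ms_cvg P (nbhs t) (fun=> cst 1) (cst 1) by exact: ms_cvg_cst.
exact: (ip_cvg (fun=> c2) y2 c2 (y2 t) ct yt).
Qed.

Let m2_continuous : continuous m2.
Proof.
move=> t; have yt := @y_ms_continuous t.
exact: (ip_cvg y2 y2 (y2 t) (y2 t) yt yt).
Qed.

Let drift (u : R) (w : T) : R := (alpha - m2 u) * y u w + m1 u * cst 1 w.

Let drift_mf u w : s <= u -> mf_drift P alpha Y u w = drift u w.
Proof.
move=> su.
have E1 : fine ('E_P[Y u])%E = m1 u.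
  by rewrite unlock /m1 yE//; congr fine; apply: eq_integral => v _ /=; rewrite mul1r.
have E2 : fine ('E_P[fun v => (Y u v ^+ 2)%R])%E = m2 u.
  by rewrite unlock /m2 yE//; congr fine; apply: eq_integral => v _ /=; rewrite expr2.
by rewrite /mf_drift E1 E2 /drift yE//=; ring.
Qed.

Let drift2 u : L2 P (drift u).
Proof. by apply: L2D; apply: L2Z => //; exact: L2_cst. Qed.

Let drift_ms_continuous t : ms_cvg P (nbhs t) drift (drift t).
Proof.
apply: ms_cvgD; try (by move=> *; apply: L2Z => //; exact: L2_cst);
  try (by apply: L2Z => //; exact: L2_cst).
- apply: ms_cvgZ => //; apply: cvgB; [exact: cvg_cst|exact: m2_continuous].
- apply: ms_cvgZ; try exact: L2_cst; try (by move=> _; exact: L2_cst).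
  + exact: m1_continuous.
  + exact: ms_cvg_cst.
Qed.

Let y_measurable : measurable_fun setT (fun p : R * T => y p.1 p.2).
Proof.
have mY := mf_measurable HY.
pose phi (p : R * T) := (Num.max s p.1, p.2).
have mphi : measurable_fun setT phi.
  apply/measurable_fun_pairP; split; last exact: measurable_snd.
  by apply: measurable_maxr; [exact: measurable_cst|exact: measurable_fst].
have mD : measurable (`[s, +oo[ `*` [set: T]) by apply: measurableX.
apply: (measurable_comp mD _ mY mphi) => _ [p _ <-].
by split => //=; rewrite in_itv/= s_max.
Qed.

Let drift_measurable : measurable_fun setT (fun p : R * T => drift p.1 p.2).
Proof.
have mfst (f : R -> R) : continuous f -> measurable_fun setT (fun p : R * T => f p.1).
  move=> cf; have mf : measurable_fun setT f by exact: continuous_measurable_fun.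
  exact: (measurableT_comp mf (@measurable_fst _ _ _ _)).
apply: measurable_funD; apply: measurable_funM => //.
- apply: measurable_funB => //; exact: mfst.
- exact: mfst.
Qed.

Let solution_at (t : R) : exists I, [/\ is_ito_integral P W s (Num.max s t) Y I &
  {ae P, forall w, y t w = X w +
    \int[mu]_(u in `[s, Num.max s t]) mf_drift P alpha Y u w + I w}].
Proof. by have [I HI HE] := mf_equation HY (s_max t); exists I. Qed.

(** The stochastic integral of the solution, chosen at each time. *)
Let ito t : T -> R := sval (cid (solution_at t)).
Let ito_integral t : is_ito_integral P W s (Num.max s t) Y (ito t).
Proof. by rewrite /ito; case: cid => ? []. Qed.
Let ito_equation t : {ae P, forall w, y t w = X w +
    \int[mu]_(u in `[s, Num.max s t]) mf_drift P alpha Y u w + ito t w}.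
Proof. by rewrite /ito; case: cid => ? []. Qed.
Let ito2 t : L2 P (ito t). Proof. by have [] := ito_integral t. Qed.

(** The drift accumulated up to time [t]. Defined as what the stochastic integral
    leaves of the solution, it is square-integrable without further argument; it
    equals the pathwise time integral almost surely. *)
Let acc t : T -> R := (y t \- X) \- ito t.
Let acc2 t : L2 P (acc t). Proof. by apply: L2B => //; exact: L2B. Qed.

Let ip_drift_continuous Z : L2 P Z -> continuous (fun u => ip P Z (drift u)).
Proof.
move=> Z2 t; have dt := @drift_ms_continuous t.
have ct : ms_cvg P (nbhs t) (fun=> Z) Z by exact: ms_cvg_cst.
exact: (ip_cvg (fun=> Z2) drift2 Z2 (drift2 t) ct dt).
Qed.

Let continuous_integrable (f : R -> R) (i : interval R) r t : continuous f ->
  [set` i] `<=` `[r, t] -> mu.-integrable [set` i] (EFin \o f).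
Proof.
move=> cf irt; apply: (@integrableS _ _ _ mu `[r, t]) => //.
apply: continuous_compact_integrable; first exact: segment_compact.
exact: continuous_subspaceT.
Qed.

Let ip_acc_segment Z t : s <= t -> L2 P Z ->
  ip P Z (acc t) = \int[mu]_(u in `[s, t]) ip P Z (drift u).
Proof.
move=> st Z2; apply: ip_time_integral => //.
  by move=> u; have du := @drift_ms_continuous u; exact: (ip_cvg drift2 drift2 _ _ du du).
apply: filterS (ito_equation t) => w; rewrite max_r// /acc /= => ->.
rewrite (@eq_Rintegral _ _ _ mu `[s, t]%classic (drift ^~ w)) => [|u].
  by rewrite addrAC addrK addrAC subrr add0r.
by rewrite inE /= in_itv/= => /andP[su _]; exact: drift_mf.
Qed.

Let ip_acc Z r t : s <= r -> r <= t -> L2 P Z ->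
  ip P Z (acc t \- acc r) = \int[mu]_(u in `]r, t]) ip P Z (drift u).
Proof.
move=> sr rt Z2; have st := le_trans sr rt.
rewrite (ipBr (acc2 t) (acc2 r) Z2) !ip_acc_segment//.
rewrite -(@Rintegral_itvB _ _ (BLeft s) (BRight t) r)//.
  by apply: (@continuous_integrable _ _ s t) => //; exact: ip_drift_continuous.
Qed.

Let m2_sqint t : s <= t -> ip P (ito t) (ito t) = \int[mu]_(u in `[s, t]) m2 u.
Proof.
move=> st; have := ito_isometry Pcomplete Wwiener (ito_integral t).
rewrite max_r// /sqint => E; rewrite /Rintegral.
transitivity (fine (ip P (ito t) (ito t))%:E) => //; rewrite -E; congr fine.
apply: eq_integral => u; rewrite inE /= in_itv/= => /andP[su _].
rewrite /m2 ip_fin// yE//; apply: eq_integral => w _; rewrite expr2//.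
Qed.

Let ito_increment r t : s <= r -> r <= t ->
  ip P (ito t \- ito r) (ito t \- ito r) = \int[mu]_(u in `]r, t]) m2 u.
Proof.
move=> sr rt; have st := le_trans sr rt.
have := ito_integral r; have := ito_integral t; rewrite !max_r// => It Ir.
rewrite (ito_increment_sqr Pcomplete Wwiener sr rt Ir It) !m2_sqint//.
rewrite (@Rintegral_itvB _ _ (BLeft s) (BRight t) r)//.
exact: (@continuous_integrable _ _ s t).
Qed.

Let ito_orth Z r t : s <= r -> r <= t -> L2 P Z -> adapted r Z ->
  ip P Z (ito t \- ito r) = 0.
Proof.
move=> sr rt; have st := le_trans sr rt.
have := ito_integral r; have := ito_integral t; rewrite !max_r// => It Ir.
exact: (ito_orthogonal Pcomplete Wwiener sr rt Ir It).
Qed.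

Let y_increment r t : y t \- y r = (acc t \- acc r) \+ (ito t \- ito r).
Proof. by apply/funext => w; rewrite /acc /=; ring. Qed.

(** By isometry the squared norm of an increment is the increment of a primitive
    of [m2], which is continuous. *)
Let ito_ms_continuous p : s < p -> ms_cvg P (nbhs p) ito (ito p).
Proof.
move=> sp; pose q t := \int[mu]_(u in `[s, t]) m2 u.
have qc : {for p, continuous q}.
  apply/differentiable_continuous/derivable1_diffP.
  have p1 : p < p + 1 by rewrite ltrDl.
  have iq : mu.-integrable `[s, p + 1] (EFin \o m2).
    exact: (@continuous_integrable _ _ s (p + 1)).
  by have [] := continuous_FTC1_closed p1 iq sp (@m2_continuous p).
have l2q r t : s <= r -> r <= t -> l2n P (ito t \- ito r) = Num.sqrt `|q t - q r|.
  move=> sr rt; have st := le_trans sr rt.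
  rewrite /l2n -[LHS]ger0_norm ?sqrtr_ge0// ger0_norm ?sqrtr_ge0//.
  congr Num.sqrt; rewrite ito_increment// /q.
  rewrite (@Rintegral_itvB _ _ (BLeft s) (BRight t) r)//; last first.
    exact: (@continuous_integrable _ _ s t).
  rewrite ger0_norm//; apply: Rintegral_ge0 => u _; exact: ip_ge0.
have lim : Num.sqrt `|q t - q p| @[t --> p] --> (Num.sqrt `|q p - q p| : R).
  apply: (continuous_comp (f := fun t => `|q t - q p|)); last exact: sqrt_continuous.
  by apply: cvg_norm; apply: cvgB => //; exact: cvg_cst.
rewrite subrr normr0 sqrtr0 in lim.
apply: cvg_trans lim; apply: near_eq_cvg.
have sn : \forall t \near p, s < t by exact: lt_nbhsr.
apply: filterS sn => t st; have [tp|/ltW pt] := leP t p; last exact/esym/(l2q _ _ (ltW sp)).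
rewrite (_ : ito t \- ito p = fun w => -1 * (ito p \- ito t) w); last first.
  by apply/funext => w /=; ring.
rewrite l2nZ ?normrN1 ?mul1r; last exact: L2B.
by rewrite (l2q _ _ (ltW st))// distrC.
Qed.

Let m1_increment r t : s <= r -> r <= t ->
  m1 t - m1 r = \int[mu]_(u in `]r, t]) ip P (cst 1) (drift u).
Proof.
move=> sr rt; rewrite /m1 -ipBr//; try exact: L2_cst.
rewrite y_increment ipDr//; try exact: L2B; try exact: L2_cst.
rewrite ito_orth//; [|exact: L2_cst|exact: adapted_cst].
by rewrite addr0 ip_acc//; exact: L2_cst.
Qed.

Let kernel r t u : R :=
  ip P ((y t \+ y r) \+ (ito t \- ito r)) (drift u) + m2 u.

(** The increment of [E Y^2] is that of the product of [Y_t - Y_r] and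
    [Y_t + Y_r]. The increment of the stochastic integral is orthogonal to
    [Y_r], so that it only meets itself and the accumulated drift. *)
Let m2_increment r t : s <= r -> r <= t ->
  m2 t - m2 r = \int[mu]_(u in `]r, t]) kernel r t u.
Proof.
move=> sr rt.
pose A := acc t \- acc r; pose D := ito t \- ito r.
have A2 : L2 P A := L2B (acc2 t) (acc2 r).
have D2 : L2 P D := L2B (ito2 t) (ito2 r).
have Z2 : L2 P ((y t \+ y r) \+ D) := L2D (L2D (y2 t) (y2 r)) D2.
have yt : y t = (y r \+ A) \+ D.
  by apply/funext => w; rewrite /A /D /acc /=; ring.
have yrD : ip P (y r) D = 0 by apply: ito_orth => //; exact: y_adapted.
have E := ip_sqr_increment (y2 r) A2 D2 yrD yt.
rewrite /m2 E (ip_acc sr rt Z2) (ito_increment sr rt) -RintegralD//.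
- by apply: (@continuous_integrable _ _ r t) => //; [exact: ip_drift_continuous|exact: subset_itv_oc_cc].
- by apply: (@continuous_integrable _ _ r t) => //; exact: subset_itv_oc_cc.
Qed.

Let is_derive_m1 p : s < p -> is_derive p 1 m1 ((alpha + 1 - m2 p) * m1 p).
Proof.
move=> sp; have c2 : L2 P (cst 1) by exact: L2_cst.
have cd := ip_drift_continuous c2.
have -> : (alpha + 1 - m2 p) * m1 p = ip P (cst 1) (drift p).
  have o2 : L2 P (fun w => m1 p * cst 1 w) by exact: L2Z.
  have yp : L2 P (fun w => (alpha - m2 p) * y p w) by exact: L2Z.
  rewrite /drift (ipDr yp o2 c2) (ipZr _ (y2 p) c2) (ipZr _ c2 c2).
  by rewrite ip_cst1 /m1; ring.
apply: (@is_derive_increment _ _ (fun _ _ u => ip P (cst 1) (drift u)) s) => //.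
- move=> r t sr rt; apply: (@continuous_integrable _ _ r t) => //.
  exact: subset_itv_oc_cc.
- apply: (@cvg_comp _ _ _ snd (fun u => ip P (cst 1) (drift u)) _ (nbhs p)); last exact: cd.
  exact: cvg_snd.
Qed.

(** As [r], [t] and [u] tend to [p], the increment of the stochastic integral
    disappears from the kernel, which tends to
    [2 E (Y_p drift_p) + E Y_p^2]. *)
Let is_derive_m2 p : s < p ->
  is_derive p 1 m2 ((2 * alpha + 1) * m2 p + 2 * m1 p ^+ 2 - 2 * m2 p ^+ 2).
Proof.
move=> sp; have c2 : L2 P (cst 1) by exact: L2_cst.
have yy2 : L2 P (y p \+ y p) := L2D (y2 p) (y2 p).
have -> : (2 * alpha + 1) * m2 p + 2 * m1 p ^+ 2 - 2 * m2 p ^+ 2 =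
    ip P ((y p \+ y p) \+ (ito p \- ito p)) (drift p) + m2 p.
  have o2 : L2 P (fun w => m1 p * cst 1 w) by exact: L2Z.
  have yp : L2 P (fun w => (alpha - m2 p) * y p w) by exact: L2Z.
  have E : (y p \+ y p) \+ (ito p \- ito p) =1 y p \+ y p.
    by move=> w /=; rewrite subrr addr0.
  rewrite (eq_ip P E (frefl (drift p))) (ipDl (y2 p) (y2 p) (drift2 p)).
  rewrite /drift (ipDr yp o2 (y2 p)) (ipZr _ (y2 p) (y2 p)) (ipZr _ c2 (y2 p)).
  by rewrite (ipC _ (y p) (cst 1)) -/(m1 p) -/(m2 p); ring.
apply: (@is_derive_increment _ _ kernel s) => //.
- move=> r t sr rt; apply: (@continuous_integrable _ _ r t) => //; last first.
    exact: subset_itv_oc_cc.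
  move=> u; apply: cvgD; last exact: m2_continuous.
  by apply: ip_drift_continuous; apply: L2D; [exact: L2D|exact: L2B].
- have pr : z.2 @[z --> ((p, p), p)] --> p by exact: cvg_snd.
  have prt : z.1.2 @[z --> ((p, p), p)] --> p.
    exact: (cvg_comp (@fst (R * R) R) snd cvg_fst cvg_snd).
  have prr : z.1.1 @[z --> ((p, p), p)] --> p.
    exact: (cvg_comp (@fst (R * R) R) fst cvg_fst cvg_fst).
  have yt : ms_cvg P (nbhs ((p, p), p)) (fun z => y z.1.2) (y p).
    exact: (cvg_comp _ _ prt (@y_ms_continuous p)).
  have yr : ms_cvg P (nbhs ((p, p), p)) (fun z => y z.1.1) (y p).
    exact: (cvg_comp _ _ prr (@y_ms_continuous p)).
  have it : ms_cvg P (nbhs ((p, p), p)) (fun z => ito z.1.2) (ito p).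
    exact: (cvg_comp _ _ prt (ito_ms_continuous sp)).
  have ir : ms_cvg P (nbhs ((p, p), p)) (fun z => ito z.1.1) (ito p).
    exact: (cvg_comp _ _ prr (ito_ms_continuous sp)).
  have du : ms_cvg P (nbhs ((p, p), p)) (fun z => drift z.2) (drift p).
    exact: (cvg_comp _ _ pr (@drift_ms_continuous p)).
  have m2u : m2 z.2 @[z --> ((p, p), p)] --> m2 p.
    exact: (cvg_comp _ _ pr (@m2_continuous p)).
  have S2 z1 z2 : L2 P (y z1 \+ y z2) := L2D (y2 z1) (y2 z2).
  have D2 z1 z2 : L2 P (ito z1 \- ito z2) := L2B (ito2 z1) (ito2 z2).
  have yi : ms_cvg P (nbhs ((p, p), p))
      (fun z => (y z.1.2 \+ y z.1.1) \+ (ito z.1.2 \- ito z.1.1))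
      ((y p \+ y p) \+ (ito p \- ito p)).
    by apply: ms_cvgD => //; [exact: ms_cvgD|exact: ms_cvgB].
  have ipc : ip P ((y z.1.2 \+ y z.1.1) \+ (ito z.1.2 \- ito z.1.1)) (drift z.2)
      @[z --> ((p, p), p)] --> ip P ((y p \+ y p) \+ (ito p \- ito p)) (drift p).
    by apply: ip_cvg => // [z|]; exact: L2D.
  exact: (cvgD ipc m2u).
Qed.

(** The integrals over a single time vanish, so that the solution starts at [X]
    almost surely. *)
Lemma solution_initial : ip P (Y s) (Y s) <= ip P X X.
Proof.
have ss := lexx s; rewrite -(yE ss).
have acc0 : ip P (acc s) (acc s) = 0.
  rewrite (ip_acc_segment ss (acc2 s)) set_itv1 Rintegral_set1//.
have ito0 : ip P (ito s) (ito s) = 0.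
  by rewrite (m2_sqint ss) set_itv1 Rintegral_set1.
have ys : y s = (X \+ acc s) \+ ito s.
  by apply/funext => w; rewrite /acc /=; ring.
have Xa := L2D X2 (acc2 s).
have : l2n P (y s) <= l2n P X + 0 + 0.
  rewrite {1}ys (le_trans (l2nD Xa (ito2 s)))// lerD//; last by rewrite /l2n ito0 sqrtr0.
  by rewrite (le_trans (l2nD X2 (acc2 s)))// lerD// /l2n acc0 sqrtr0.
rewrite !addr0 -!sqr_l2n => H.
by rewrite ler_sqr ?nnegrE ?l2n_ge0.
Qed.

(** At the initial time the square of the first moment is at most the second, by
    Cauchy-Schwarz, so that the decay of the moment equations applies. *)
Lemma solution_decay t : s <= t ->
  ip P (Y t) (Y t) <= 3 * ip P X X * expR (2 * (alpha + 1) * (t - s)).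
Proof.
move=> st.
have m12 : m1 s ^+ 2 <= m2 s.
  have := ip_cauchy_schwarz (L2_cst P 1) (y2 s).
  by rewrite ip_cst1 mul1r.
have := moment_equations_decay m1_continuous m2_continuous (fun u => ip_ge0 P (y u))
  is_derive_m1 is_derive_m2 m12 st.
rewrite /m2 yE// => /le_trans; apply.
rewrite ler_wpM2r ?expR_ge0// ler_wpM2l// yE//; exact: solution_initial.
Qed.

End solution_moments.

(** * Decay under the random dynamical system *)

Section mean_square_random_variables.
Context {d : measure_display} {T : measurableType d} {R : realType}.
Variable P : probability T R.

Lemma ip_ae_eq (f g : T -> R) : L2 P f -> L2 P g -> f = g %[ae P] ->
  ip P f f = ip P g g.
Proof.
move=> f2 g2 fg; congr fine; apply: ae_eq_integral => //.
- apply/measurable_EFinP; apply: measurable_funM; exact: (L2_measurable f2).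
- apply/measurable_EFinP; apply: measurable_funM; exact: (L2_measurable g2).
- by apply: filterS fg => w fgw _; rewrite fgw.
Qed.

Lemma msspace_L2 (X : msspace P) : L2 P X.
Proof. exact: msspace_Lfun. Qed.

Lemma ip_ms0 : ip P (ms0 P) (ms0 P) = 0.
Proof.
have c2 : L2 P (cst 0) by exact: L2_cst.
rewrite (ip_ae_eq (msspace_L2 (ms0 P)) c2); first by apply: ip_eq0 => w; rewrite mul0r.
exact: ms0_aeqE.
Qed.

Lemma mdist_ms0 (X : msspace P) : mdist X (ms0 P) = l2n P X.
Proof.
transitivity (l2n P (X \- ms0 P)).
  by rewrite -ms_normE//; apply: L2B; exact: msspace_L2.
rewrite /l2n (ip_ae_eq (L2B (msspace_L2 X) (msspace_L2 (ms0 P))) (msspace_L2 X))//.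
apply: filterS (ms0_aeqE P) => w w0 _.
have {}w0 : (ms0 P : T -> R) w = 0 by exact: (w0 I).
by rewrite /= w0 subr0.
Qed.

(** The representative of the zero class vanishes almost surely, so that its
    preimages are null or have null complement, and the filtration contains the
    null sets. *)
Lemma ms0_adapted (W : R -> T -> R) t : msspace_at W t (ms0 P).
Proof.
have [N [mN N0 sN]] := ms0_aeqE P.
have null (A : set T) : (forall w, A w -> (ms0 P : T -> R) w <> 0) -> P.-negligible A.
  move=> A0; exists N; split => //; apply: subset_trans sN => w Aw /= H.
  by apply: (A0 w Aw); exact: H.
move=> B mB; have [B0|B0] := pselect (B 0); last first.
  apply: sub_sigma_algebra; right; apply: null => w /= Bw w0.
  by apply: B0; rewrite -w0.
rewrite -[X in natural_filtration _ _ _ X]setCK; apply: sigma_algebraC.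
apply: sub_sigma_algebra; right; apply: null => w /= Bw w0.
by apply: Bw; rewrite /= w0.
Qed.

End mean_square_random_variables.

Section attraction.
Context {d : measure_display} {T : measurableType d} {R : realType}.
Variables (P : probability T R) (W : R -> T -> R).
Hypothesis Pcomplete : measure_is_complete P.
Hypothesis Wwiener : two_sided_wiener P W.
Variables (alpha : R) (phi : R -> R -> msspace P -> msspace P).
Hypothesis phi_gen : generated_ms_rds W alpha phi.

(** The system is given by some solution for each initial value, and the decay
    holds for every solution. *)
Lemma ms_rds_decay s t (X : msspace P) : s <= t -> msspace_at W s X ->
  l2n P (phi t s X) <= Num.sqrt 3 * l2n P X * expR ((alpha + 1) * (t - s)).
Proof.
move=> st Xs; have [Y HY phiY] := phi_gen Xs.
have Y2 : L2 P (Y t) by exact: mf_square_integrable HY _ st.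
have := solution_decay Pcomplete Wwiener (msspace_L2 X) HY st.
rewrite -(ip_ae_eq (msspace_L2 _) Y2 (phiY _ st)) => H.
rewrite -ler_sqr ?nnegrE ?mulr_ge0 ?l2n_ge0 ?sqrtr_ge0 ?expR_ge0//.
rewrite !exprMn !sqr_l2n sqr_sqrtr// -expRM_natl.
by rewrite mulrA.
Qed.

Lemma ms_rds_fixes_ms0 s t : s <= t -> phi t s (ms0 P) = ms0 P.
Proof.
move=> st; have := ms_rds_decay st (@ms0_adapted _ _ _ P W s).
rewrite {2}/l2n ip_ms0 sqrtr0 mulr0 mul0r => le0.
apply: msdist_positivity; apply/eqP; rewrite eq_le.
have -> : msdist (phi t s (ms0 P)) (ms0 P) = l2n P (phi t s (ms0 P)) := mdist_ms0 _.
by rewrite le0 l2n_ge0.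
Qed.

Lemma decay_to_past (t k c : R) : 0 <= k -> c < 0 ->
  k * expR (c * (t - s)) @[s --> -oo] --> 0.
Proof.
move=> k0 c0; apply/cvgrPdist_le => e e0; near=> s.
have st : s < t by near: s; apply: nbhs_ninfty_lt; rewrite num_real.
have c0' : 0 < - c by rewrite oppr_gt0.
have x0 : 0 < - c * (t - s) by rewrite mulr_gt0// subr_gt0.
rewrite sub0r normrN ger0_norm ?mulr_ge0 ?expR_ge0//.
rewrite -[c]opprK mulNr expRN ler_pdivrMr ?expR_gt0//.
apply: (@le_trans _ _ (e * (- c * (t - s)))); last first.
  by rewrite ler_wpM2l ?(ltW e0)// (le_trans _ (expR_ge1Dx _))// lerDr.
rewrite mulrA -ler_pdivrMl ?mulr_gt0// lerBrDr -lerBrDl.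
by near: s; apply: nbhs_ninfty_le; rewrite num_real.
Unshelve. all: by end_near. Qed.

End attraction.

(** * The pullback attractor *)

Theorem theorem13 (d : measure_display) (T : measurableType d) (R : realType)
    (P : probability T R) (Pcomplete : measure_is_complete P)
    (W : R -> T -> R) (W_wiener : two_sided_wiener P W)
    (alpha : R) (alpha_lt : alpha < -1)
    (phi : R -> R -> msspace P -> msspace P)
    (phi_gen : generated_ms_rds W alpha phi) :
  pullback_attractor W phi (fun=> [set ms0 P]).
Proof.
split.
- by move=> t; exists (ms0 P).
- by move=> t; exact: compact_set1.
- by move=> t _ ->; exact: ms0_adapted.
- move=> s t st; rewrite image_set1.
  by rewrite (ms_rds_fixes_ms0 Pcomplete W_wiener phi_gen st).
move=> D D0 Dad [r r0 Dr] t.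
pose bound s := Num.sqrt 3 * r * expR ((alpha + 1) * (t - s)).
have bound0 : bound s @[s --> -oo] --> 0.
  apply: decay_to_past; first by rewrite mulr_ge0 ?sqrtr_ge0// ltW.
  lra.
have dist0 (X : msspace P) :
    ereal_inf [set (mdist X y)%:E | y in [set ms0 P]] = (l2n P X)%:E.
  by rewrite image_set1 ereal_inf1 mdist_ms0.
apply: (@squeeze_cvge _ _ _ _ (cst 0%E) _ (EFin \o bound)).
- near=> s; apply/andP; split.
    have [X DX] := D0 s; apply: (@le_trans _ _ (l2n P (phi t s X))%:E).
      by rewrite lee_fin l2n_ge0.
    by apply: ereal_sup_ubound; exists (phi t s X); [exists X|exact: dist0].
  apply: ub_ereal_sup => _ [_ [X DX <-] <-]; rewrite dist0 lee_fin.
  have st : s <= t by near: s; apply: nbhs_ninfty_le; rewrite num_real.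
  apply: le_trans (ms_rds_decay Pcomplete W_wiener phi_gen st (Dad _ _ DX)) _.
  rewrite ler_wpM2r ?expR_ge0// ler_wpM2l ?sqrtr_ge0//.
  by rewrite -ms_normE; [exact: Dr DX|exact: msspace_L2].
- exact: cvg_cst.
- by apply: cvg_EFin; [exact: nearW|exact: bound0].
Unshelve. all: by end_near. Qed.
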